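(* Let $A,B,C\in\mathbb{Z}$ and $F(x,y)=Ax^4+Bx^3y+(C-2A)x^2y^2-Bxy^3+Ay^4$. (a) For an odd prime $p$, $Q_F$ is maximal at $p$ if and only if $p$ does not divide all of $A,B,C$, $B^2-4AC\not\equiv0\pmod{p^2}$, and: $(4A-C)^2+4B^2\not\equiv 0\pmod{p^3}$ when $p$ divides both $4A-C$ and $B$; $(4A-C)^2+4B^2\not\equiv0\pmod{p^2}$ when $p$ does not divide both $4A-C$ and $B$. (b) $Q_F$ is maximal at $2$ if and only if $A,B,C$ are not all even, $C\not\equiv0\pmod4$, and, when $C$ is odd and $B$ is even, $A\not\equiv0\pmod 4$ and $A-B+C\not\equiv0\pmod4$.
   Context: For an integral binary quartic form $F=a_4x^4+a_3x^3y+a_2x^2y^2+a_1xy^3+a_0y^4$, $Q_F$ is the quartic ring associated to $F$ by Birch–Merriman/Nakagawa (equivalently, by Wood, the quartic ring corresponding under Bhargava's parametrization to the pair of ternary quadratic forms $(U_0,V_F)$ with $U_0=-xy+z^2$, $V_F=a_0x^2+a_4y^2+a_2z^2+a_1xz+a_3yz$); when $F$ is irreducible and $\theta$ is a root of $F(x,1)$, $Q_F=\mathbb{Z}\oplus\mathbb{Z}a_4\theta\oplus\mathbb{Z}(a_4\theta^2+a_3\theta)\oplus\mathbb{Z}(a_4\theta^3+a_3\theta^2+a_2\theta)$. $Q_F$ is maximal at a prime $p$ if $\mathbb{Z}_p\otimes_{\mathbb{Z}}Q_F$ is a maximal quartic ring over $\mathbb{Z}_p$. *)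

(* Defs.v *)
From HB Require Import structures.
From mathcomp Require Import all_boot all_order all_algebra.
From mathcomp Require Import boolp.
From mathcomp Require Import ring.

Set Implicit Arguments.
Unset Strict Implicit.
Unset Printing Implicit Defensive.

Import GRing.Theory.

Local Open Scope ring_scope.

(* p-adic integers, as the inverse limit of the rings Z/p^(n+1).  The p of    *)
(* interest is at least 2; this matters because 'Z_m is Z/m only for m > 1.   *)
Section PadicInt.
Variable p : nat.

Record padic_int := PadicInt {
  padic_res :> forall n, 'Z_(p ^ n.+1);
  padic_resP : forall n, padic_res n = (padic_res n.+1 : nat)%:R
}.

Lemma padic_eq (x y : padic_int) : (forall n, x n = y n) -> x = y.
Proof.
case: x y => [x xP] [y yP] /= exy.
have {}exy : x = y by apply: functional_extensionality_dep.
by case: _ / exy yP => yP; congr PadicInt; apply: Prop_irrelevance.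
Qed.

HB.instance Definition _ := gen_eqMixin padic_int.
HB.instance Definition _ := gen_choiceMixin padic_int.

Fact padic_char_dvd n :
  ((Zp_trunc (p ^ n.+1)).+2 %| (Zp_trunc (p ^ n.+2)).+2)%N.
Proof.
case: p => [|[|q]]; rewrite ?exp1n ?exp0n //.
have exp_gt1 m : (1 < q.+2 ^ m.+1)%N by rewrite -{1}(expn0 q.+2) ltn_exp2l.
by rewrite !Zp_cast // dvdn_exp2l.
Qed.

Fact padic_natr_mod n (k : nat) :
  (k %% (Zp_trunc (p ^ n.+2)).+2)%:R = k%:R :> 'Z_(p ^ n.+1).
Proof.
by apply: val_inj; rewrite /= !Zp_nat /= modn_dvdm // padic_char_dvd.
Qed.

Fact padic_natr n (k : nat) :
  k%:R = ((k%:R : 'Z_(p ^ n.+2)) : nat)%:R :> 'Z_(p ^ n.+1).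
Proof. by rewrite [X in (nat_of_ord X)%:R]Zp_nat /= padic_natr_mod. Qed.

Fact padic_addP (x y : padic_int) n :
  x n + y n = ((x n.+1 + y n.+1)%R : nat)%:R.
Proof. by rewrite /= padic_natr_mod natrD -!padic_resP. Qed.

Fact padic_mulP (x y : padic_int) n :
  x n * y n = ((x n.+1 * y n.+1)%R : nat)%:R.
Proof. by rewrite /= padic_natr_mod natrM -!padic_resP. Qed.

Fact padic_oppP (x : padic_int) n :
  - x n = ((- x n.+1)%R : nat)%:R.
Proof.
apply: (addrI (x n)); rewrite subrr [X in X + _]padic_resP -natrD.
rewrite -padic_natr_mod.
have /(congr1 (@nat_of_ord _)) /= -> := subrr (x n.+1).
by [].
Qed.

Definition padic_zero := PadicInt (fun n => padic_natr n 0).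
Definition padic_one := PadicInt (fun n => padic_natr n 1).
Definition padic_add x y := PadicInt (padic_addP x y).
Definition padic_opp x := PadicInt (padic_oppP x).
Definition padic_mul x y := PadicInt (padic_mulP x y).

Fact padic_addA : associative padic_add.
Proof. by move=> x y z; apply: padic_eq => n; rewrite /= addrA. Qed.
Fact padic_addC : commutative padic_add.
Proof. by move=> x y; apply: padic_eq => n; rewrite /= addrC. Qed.
Fact padic_add0 : left_id padic_zero padic_add.
Proof. by move=> x; apply: padic_eq => n; rewrite /= add0r. Qed.
Fact padic_addN : left_inverse padic_zero padic_opp padic_add.
Proof. by move=> x; apply: padic_eq => n; rewrite /= addNr. Qed.

HB.instance Definition _ := GRing.isZmodule.Build padic_int
  padic_addA padic_addC padic_add0 padic_addN.

Fact padic_mulA : associative padic_mul.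
Proof. by move=> x y z; apply: padic_eq => n; rewrite /= mulrA. Qed.
Fact padic_mulC : commutative padic_mul.
Proof. by move=> x y; apply: padic_eq => n; rewrite /= mulrC. Qed.
Fact padic_mul1 : left_id padic_one padic_mul.
Proof. by move=> x; apply: padic_eq => n; rewrite /= mul1r. Qed.
Fact padic_mulDl : left_distributive padic_mul +%R.
Proof. by move=> x y z; apply: padic_eq => n; rewrite /= mulrDl. Qed.
Fact padic_oner_neq0 : padic_one != 0.
Proof.
by apply/eqP => /(congr1 (fun x : padic_int => x 0%N)) /eqP; rewrite oner_eq0.
Qed.

HB.instance Definition _ := GRing.Zmodule_isComNzRing.Build padic_int
  padic_mulA padic_mulC padic_mul1 padic_mulDl padic_oner_neq0.

End PadicInt.

(* a4 x^4 + a3 x^3 y + a2 x^2 y^2 + a1 x y^3 + a0 y^4 *)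
Record binary_quartic (R : Type) := BinaryQuartic {
  bq4 : R; bq3 : R; bq2 : R; bq1 : R; bq0 : R
}.

Definition bq_eval (R : pzRingType) (F : binary_quartic R) (x y : R) : R :=
  bq4 F * x ^+ 4 + bq3 F * x ^+ 3 * y + bq2 F * x ^+ 2 * y ^+ 2
  + bq1 F * x * y ^+ 3 + bq0 F * y ^+ 4.

Definition map_bq (R S : Type) (f : R -> S) (F : binary_quartic R) :=
  BinaryQuartic (f (bq4 F)) (f (bq3 F)) (f (bq2 F)) (f (bq1 F)) (f (bq0 F)).

(* The Birch-Merriman/Nakagawa ring of F over R: the free R-module on         *)
(* w_0 = 1, w_1, w_2, w_3, whose structure constants are those of             *)
(*   w_1 = a4 t, w_2 = a4 t^2 + a3 t, w_3 = a4 t^3 + a3 t^2 + a2 t            *)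
(* for t a root of F(x, 1) (see bq_ring_valM); being given by its             *)
(* multiplication table, it makes sense for every F, even F = 0.              *)
Definition bq_ring (R : comNzRingType) (F : binary_quartic R) : Type :=
  'rV[R]_4.

Section QuarticRing.
Variables (R : comNzRingType) (F : binary_quartic R).

Let a4 := bq4 F. Let a3 := bq3 F. Let a2 := bq2 F.
Let a1 := bq1 F. Let a0 := bq0 F.

(* coordinates of w_i * w_j on w_0, w_1, w_2, w_3 *)
Definition bq_table : seq (seq (seq R)) :=
  let w01 := [:: 0; 1; 0; 0] in
  let w02 := [:: 0; 0; 1; 0] in
  let w03 := [:: 0; 0; 0; 1] in
  let w11 := [:: 0; - a3; a4; 0] in
  let w12 := [:: 0; - a2; 0; a4] in
  let w13 := [:: - (a0 * a4); - a1; 0; 0] in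
  let w22 := [:: - (a0 * a4); - a1; - a2; a3] in
  let w23 := [:: - (a0 * a3); - a0; - a1; 0] in
  let w33 := [:: - (a0 * a2); 0; - a0; - a1] in
  [:: [:: [:: 1; 0; 0; 0]; w01; w02; w03];
      [:: w01; w11; w12; w13];
      [:: w02; w12; w22; w23];
      [:: w03; w13; w23; w33]].

HB.instance Definition _ := GRing.Lmodule.on (bq_ring F).

Definition bq_one : bq_ring F := delta_mx 0 0.

Definition bq_mul (x y : bq_ring F) : bq_ring F :=
  \sum_(i < 4) \sum_(j < 4)
    (x 0 i * y 0 j) *: (\row_k (nth [::] (nth [::] bq_table i) j)`_k).

Fact bq_mulE (x y : bq_ring F) (k : 'I_4) :
  bq_mul x y 0 k = \sum_(i < 4) \sum_(j < 4)
    x 0 i * y 0 j * (nth [::] (nth [::] bq_table i) j)`_k.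
Proof.
rewrite summxE; apply: eq_bigr => i _; rewrite summxE.
by apply: eq_bigr => j _; rewrite !mxE.
Qed.

Let i1 : 'I_4 := lift ord0 ord0.
Let i2 : 'I_4 := lift ord0 (lift ord0 ord0).
Let i3 : 'I_4 := lift ord0 (lift ord0 (lift ord0 ord0)).

Fact bq_ring_ext (x y : bq_ring F) : x 0 0 = y 0 0 -> x 0 i1 = y 0 i1 ->
  x 0 i2 = y 0 i2 -> x 0 i3 = y 0 i3 -> x = y.
Proof.
move=> e0 e1 e2 e3; apply/rowP=> -[[|[|[|[|//]]]] lt_k].
- by rewrite (_ : Ordinal _ = 0) //; apply: val_inj.
- by rewrite (_ : Ordinal _ = i1) //; apply: val_inj.
- by rewrite (_ : Ordinal _ = i2) //; apply: val_inj.
- by rewrite (_ : Ordinal _ = i3) //; apply: val_inj.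
Qed.

Fact bq_mulC : commutative bq_mul.
Proof.
move=> x y; apply: bq_ring_ext; rewrite !bq_mulE !big_ord_recl !big_ord0 /=; ring.
Qed.

Fact bq_mul1 : left_id bq_one bq_mul.
Proof.
move=> x; apply: bq_ring_ext;
  rewrite !bq_mulE !big_ord_recl !big_ord0 /= !mxE /= /i1 /i2 /i3; ring.
Qed.

Fact bq_mulDl : left_distributive bq_mul +%R.
Proof.
move=> x y z; apply/rowP => k; rewrite mxE !bq_mulE -big_split.
apply: eq_bigr => i _; rewrite -big_split.
by apply: eq_bigr => j _; rewrite !mxE !mulrDl.
Qed.

Let t i j k : R := (nth [::] (nth [::] bq_table i) j)`_k.

Fact bq_tableA (i j k l : 'I_4) :
  \sum_(m < 4) t j k m * t i m l = \sum_(m < 4) t i j m * t m k l.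
Proof.
rewrite !big_ord_recl !big_ord0 /t.
case: i => [[|[|[|[|//]]]] lt_i]; case: j => [[|[|[|[|//]]]] lt_j];
case: k => [[|[|[|[|//]]]] lt_k]; case: l => [[|[|[|[|//]]]] lt_l];
rewrite /=; ring.
Qed.

Fact bq_mulA : associative bq_mul.
Proof.
move=> x y z; apply/rowP => l; rewrite bq_mulE [RHS]bq_mulE.
transitivity (\sum_(i < 4) \sum_(j < 4) \sum_(k < 4)
    x 0 i * y 0 j * z 0 k * (\sum_(m < 4) t j k m * t i m l)).
  apply: eq_bigr => i _.
  under eq_bigr => m _ do rewrite bq_mulE mulr_sumr mulr_suml.
  rewrite exchange_big; apply: eq_bigr => j _.
  under eq_bigr => m _ do rewrite mulr_sumr mulr_suml.
  rewrite exchange_big; apply: eq_bigr => k _; rewrite mulr_sumr.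
  by apply: eq_bigr => m _; rewrite -/(t i m l) -/(t j k m); ring.
under [RHS]eq_bigr => m _ do
  under eq_bigr => k _ do (rewrite bq_mulE !mulr_suml;
    under eq_bigr => i _ do rewrite !mulr_suml).
rewrite [RHS]exchange_big.
under [RHS]eq_bigr => k _ do rewrite exchange_big.
rewrite [RHS]exchange_big; apply: eq_bigr => i _.
under [RHS]eq_bigr => k _ do rewrite exchange_big.
rewrite [RHS]exchange_big; apply: eq_bigr => j _; apply: eq_bigr => k _.
rewrite bq_tableA mulr_sumr; apply: eq_bigr => m _.
by rewrite -/(t i j m) -/(t m k l); ring.
Qed.

Fact bq_one_neq0 : bq_one != 0.
Proof. by apply/eqP => /rowP/(_ 0) /eqP; rewrite !mxE /= oner_eq0. Qed.

HB.instance Definition _ := GRing.Zmodule_isComNzRing.Build (bq_ring F)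
  bq_mulA bq_mulC bq_mul1 bq_mulDl bq_one_neq0.

Fact bq_scalerAl (c : R) (x y : bq_ring F) : c *: (x * y) = (c *: x) * y.
Proof.
apply/rowP => k; rewrite mxE [in LHS]bq_mulE [RHS]bq_mulE mulr_sumr.
apply: eq_bigr => i _; rewrite mulr_sumr.
by apply: eq_bigr => j _; rewrite mxE !mulrA.
Qed.

HB.instance Definition _ :=
  GRing.Lmodule_isLalgebra.Build R (bq_ring F) bq_scalerAl.
HB.instance Definition _ := GRing.Lalgebra_isComAlgebra.Build R (bq_ring F).

Definition bq_ring_val (K : comNzRingType) (f : R -> K) (t : K)
    (x : bq_ring F) : K :=
  f (x 0 0) + f (x 0 i1) * (f a4 * t) + f (x 0 i2) * (f a4 * t ^+ 2 + f a3 * t)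
  + f (x 0 i3) * (f a4 * t ^+ 3 + f a3 * t ^+ 2 + f a2 * t).

End QuarticRing.

Lemma bq_ring_valM (R K : comNzRingType) (F : binary_quartic R)
    (f : {rmorphism R -> K}) (t : K) :
  bq_eval (map_bq f F) t 1 = 0 ->
  {morph bq_ring_val f t : x y / (x : bq_ring F) * y >-> x * y}.
Proof.
rewrite /bq_eval /= !expr1n !mulr1 => Ft0 x y.
have fa0 : f (bq0 F) = - (f (bq4 F) * t ^+ 4 + f (bq3 F) * t ^+ 3
                         + f (bq2 F) * t ^+ 2 + f (bq1 F) * t).
  by apply/eqP; rewrite -addr_eq0 addrC; apply/eqP.
rewrite /bq_ring_val !bq_mulE !big_ord_recl !big_ord0 /=.
rewrite !(rmorphD, rmorphM, rmorphN, rmorph0, rmorph1) fa0; ring.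
Qed.

(* R (x)_Z Q_F: as Q_F is Z-free, this is the free R-module with the same     *)
(* structure constants; see bq_ring_tensor_universal.                         *)
Definition bq_ring_tensor (R : comNzRingType) (F : binary_quartic int) :
  comAlgType R := bq_ring (map_bq (fun m : int => m%:~R : R) F).

Section BaseChange.
Variables (R : comNzRingType) (F : binary_quartic int).

Definition bq_ring_to_tensor (x : bq_ring F) : bq_ring_tensor R F :=
  map_mx (fun m : int => m%:~R : R) x.

Fact bq_ring_to_tensor_is_additive : zmod_morphism bq_ring_to_tensor.
Proof. by move=> x y; apply/rowP => k; rewrite !mxE rmorphB. Qed.

Lemma bq_table_map i j k :
  (nth [::] (nth [::] (bq_table (map_bq (fun m : int => m%:~R : R) F)) i) j)`_k
  = ((nth [::] (nth [::] (bq_table F) i) j)`_k)%:~R.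
Proof.
by do 4?[case: i => [|i] /=]; do 4?[case: j => [|j] /=];
  do 4?[case: k => [|k] /=];
  rewrite ?nth_nil // ?(rmorphN, rmorphM, rmorph0, rmorph1).
Qed.

Fact bq_ring_to_tensor_is_monoid_morphism : monoid_morphism bq_ring_to_tensor.
Proof.
split=> [|x y]; apply/rowP => k.
  by rewrite !mxE rmorph_nat.
rewrite mxE [in LHS]bq_mulE [RHS]bq_mulE rmorph_sum.
apply: eq_bigr => i _; rewrite rmorph_sum; apply: eq_bigr => j _.
by rewrite !rmorphM !mxE bq_table_map.
Qed.

HB.instance Definition _ := GRing.isZmodMorphism.Build
  (bq_ring F) (bq_ring_tensor R F) bq_ring_to_tensor
  bq_ring_to_tensor_is_additive.
HB.instance Definition _ := GRing.isMonoidMorphism.Build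
  (bq_ring F) (bq_ring_tensor R F) bq_ring_to_tensor
  bq_ring_to_tensor_is_monoid_morphism.

Lemma bq_ring_tensor_universal (S : comAlgType R)
    (g : {rmorphism bq_ring F -> S}) :
  exists h : {lrmorphism bq_ring_tensor R F -> S},
    (forall x, h (bq_ring_to_tensor x) = g x) /\
    (forall h' : {lrmorphism bq_ring_tensor R F -> S},
       (forall x, h' (bq_ring_to_tensor x) = g x) -> h' =1 h).
Proof.
pose w (i : 'I_4) : bq_ring F := delta_mx 0 i.
pose hf (z : bq_ring_tensor R F) : S := \sum_(i < 4) z 0 i *: g (w i).
have hw (x : bq_ring F) : g x = \sum_(i < 4) (x 0 i)%:~R *: g (w i).
  rewrite [in LHS](matrix_sum_delta x) big_ord1 raddf_sum.
  apply: eq_bigr => i _; rewrite scaler_int -raddfMz.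
  by congr (g _); rewrite -[X in X *: _]intz scaler_int.
have h_lin : linear hf.
  move=> c u v; rewrite scaler_sumr -big_split; apply: eq_bigr => i _.
  by rewrite !mxE scalerDl scalerA.
have hM u v : hf (u * v) = hf u * hf v.
  rewrite /hf mulr_suml.
  under eq_bigr => k _ do rewrite bq_mulE scaler_suml.
  rewrite exchange_big; apply: eq_bigr => i _.
  under eq_bigr => k _ do rewrite scaler_suml.
  rewrite exchange_big mulr_sumr; apply: eq_bigr => j _.
  rewrite -scalerAl -scalerAr scalerA -rmorphM hw scaler_sumr.
  apply: eq_bigr => k _; rewrite scalerA bq_table_map bq_mulE.
  congr ((_ * _%:~R) *: _).
  rewrite (bigD1 i) //= [X in _ + X]big1 => [|m /negbTE mi].
    rewrite addr0 (bigD1 j) //= [X in _ + X]big1 => [|m /negbTE mj].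
      by rewrite addr0 !mxE !eqxx !mul1r.
    by rewrite !mxE mj andbF mulr0 mul0r.
  by apply: big1 => m' _; rewrite !mxE mi andbF !mul0r.
have hi x : hf (bq_ring_to_tensor x) = g x.
  by rewrite hw; apply: eq_bigr => i _; rewrite mxE.
have h1 : hf 1 = 1.
  by rewrite -(rmorph1 g) -hi rmorph1.
pose hz := GRing.isLinear.Build R (bq_ring_tensor R F) S *:%R hf h_lin.
pose hm := GRing.isMonoidMorphism.Build (bq_ring_tensor R F) S hf (conj h1 hM).
pose h : {lrmorphism bq_ring_tensor R F -> S} := HB.pack hf hz hm.
exists h; split=> // h' h'i z.
rewrite [in LHS](matrix_sum_delta z) big_ord1 (linear_sum h').
apply: eq_bigr => i _; rewrite (linearZ_LR h') -h'i; congr (_ *: h' _).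
by apply/rowP => j; rewrite !mxE rmorph_nat.
Qed.

End BaseChange.

Definition quartic_ring (R : comNzRingType) (S : comAlgType R) : Prop :=
  inhabited (Vector.axiom 4 S).

(* T is any quartic ring containing a copy of S, so this says that S is not   *)
(* properly contained in a quartic ring over R.                               *)
Definition maximal_quartic_ring (R : comNzRingType) (S : comAlgType R) : Prop :=
  quartic_ring S /\
  forall (T : comAlgType R) (f : {lrmorphism S -> T}),
    quartic_ring T -> injective f -> bijective f.

Definition maximal_at (p : nat) (F : binary_quartic int) : Prop :=
  maximal_quartic_ring (bq_ring_tensor (padic_int p) F).

(* Main.v *)
Require Import Defs.
From HB Require Import structures.
From mathcomp Require Import all_boot all_order all_algebra.
From mathcomp Require Import boolp ring.

Set Implicit Arguments.
Unset Strict Implicit.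
Unset Printing Implicit Defensive.

Import GRing.Theory.

Local Open Scope ring_scope.

(* For a quartic ring S over Z_p, an injection f : S -> T of quartic rings    *)
(* which is not onto is not injective modulo p, so the ideal J of those x     *)
(* with f x in p T is strictly larger than p S, and by Cayley-Hamilton in T   *)
(* its elements are nilpotent modulo p. When S = Z_p[theta] with theta a      *)
(* root of P, this forces P into the square of the ideal (h, p) for some      *)
(* irreducible factor h of P mod p (Dedekind's criterion); conversely each    *)
(* such h, of degree 1 or 2, gives an explicit overring. The form F is        *)
(* A u^2 + B u v + C v^2 in u = x^2 - y^2 and v = x y, and the map            *)
(* (x : y) -> (u : v) is branched exactly over u^2 + 4 v^2 = (x^2 + y^2)^2.   *)
(* For odd p, a singular point away from the branch locus makes B^2 - 4 A C   *)
(* divisible by p^2, and one on it makes the resultant (4 A - C)^2 + 4 B^2    *)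
(* of the two quadratic forms divisible by p^2, or by p^3 when p divides both *)
(* 4 A - C and B. If p | A, the substitution (x, y) -> (x + y, x) gives the   *)
(* leading coefficient C; if p | A and p | C then F = B x y (x^2 - y^2)       *)
(* modulo p, and nilpotent elements are those vanishing at 0, 1, -1 and       *)
(* infinity.                                                                  *)

(** * The p-adic integers *)

(** Write [F = q(u, v)] with [u = x^2 - y^2], [v = x y] and [q = A u^2 + B u v + C v^2], over a
    local ring with maximal ideal generated by [pi]. Apart from the case where [pi] divides all of
    [F], non-maximality comes from a monic [H] of degree 1 or 2 such that [F(X, 1)] lies in the
    square of the ideal [(H, pi)]. That such an [H] yields an overring is shown by
    [not_maximal_linear] and [not_maximal_quadratic]; that an overring yields such an [H], when the
    leading coefficient is a unit, is [dedekind] and its specialisation [maximal_of_dedekind].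

    For this family a linear [H] is a point where [F] vanishes modulo [pi^2] and is singular modulo
    [pi]. Away from the ramification of [(u : v)] it forces a double root of [q], hence a condition
    on the discriminant [D]; on the ramification it forces [q] to meet [u^2 + 4 v^2], hence a
    condition on the resultant [E]. A quadratic [H = X^2 - r X + s] must have [s = -1] or [s = 1]
    modulo [pi]: the first is the fibre [u = r v] and again concerns [q], the second reduces for odd
    residue characteristic to [X^2 + 1], that is to the ramification. At 2 only three points of the
    projective line and two values of [r] have to be inspected. [family_maximal] reduces maximality
    to these exclusions, and [maximal_degenerate] covers the case without a unit among [A] and
    [C]. *)

Section PadicFacts.
Variable p : nat.
Hypothesis p_pr : prime p.

Lemma padic_expn_gt1 n : (1 < p ^ n.+1)%N.
Proof. by rewrite -(exp1n n.+1) ltn_exp2r // prime_gt1. Qed.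

Lemma padic_natr_eq0 n m : ((m%:R : 'Z_(p ^ n.+1)) == 0) = (p ^ n.+1 %| m)%N.
Proof. by rewrite -(inj_eq val_inj) /= val_Zp_nat ?padic_expn_gt1. Qed.

Lemma padic_natr_eq n a b :
  ((a%:R : 'Z_(p ^ n.+1)) == b%:R) = (a == b %[mod p ^ n.+1])%N.
Proof. by rewrite -(inj_eq val_inj) /= !val_Zp_nat ?padic_expn_gt1. Qed.

Lemma padic_res_natr (x : padic_int p) n : x n = (x n : nat)%:R.
Proof. by rewrite natr_Zp. Qed.

Lemma padic_natrE m n : (m%:R : padic_int p) n = m%:R.
Proof. by elim: m => [|m IHm] //; rewrite !mulrS -IHm. Qed.

Lemma padic_intrE (m : int) n : (m%:~R : padic_int p) n = m%:~R.
Proof.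
by case: m => m;
  rewrite ?NegzE ?mulrNz -?pmulrn -[LHS]/(_ n) /= ?padic_natrE.
Qed.

Lemma padic_res_mod (x : padic_int p) n :
  (x n.+1 == x n %[mod p ^ n.+1])%N.
Proof. by rewrite -padic_natr_eq -padic_resP natr_Zp. Qed.

(** Multiplication by [p] loses one digit, so component [n] of [x] is controlled by component [n.+1]
    of [p x]. *)
Lemma padic_pmulI (x : padic_int p) : p%:R * x = 0 -> x = 0.
Proof.
move=> px0; apply: padic_eq => n; apply/eqP.
rewrite padic_resP padic_natr_eq0 -(dvdn_pmul2l (prime_gt0 p_pr)) -expnS.
rewrite -padic_natr_eq0 natrM natr_Zp -padic_natrE.
by apply/eqP; exact: (congr1 (fun y : padic_int p => y n.+1) px0).
Qed.

Definition padic_red (x : padic_int p) : 'F_p := (x 0 : nat)%:R.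

Lemma padic_red_natr m : ((m%:R : 'Z_(p ^ 1)) : nat)%:R = m%:R :> 'F_p.
Proof. by rewrite val_Zp_nat ?padic_expn_gt1 // expn1 Fp_nat_mod. Qed.

Fact padic_red_is_zmod_morphism : zmod_morphism padic_red.
Proof.
move=> x y; apply/eqP; rewrite eq_sym subr_eq; apply/eqP.
rewrite -natrD -padic_red_natr natrD !natr_Zp.
by rewrite /padic_red -[in LHS](subrK (y 0) (x 0)).
Qed.

Fact padic_red_is_monoid_morphism : monoid_morphism padic_red.
Proof.
split=> [|x y]; first exact: padic_red_natr.
by rewrite /padic_red -natrM -[RHS]padic_red_natr natrM !natr_Zp.
Qed.

Definition padic_residue : {rmorphism padic_int p -> 'F_p} :=
  HB.pack padic_red
    (GRing.isZmodMorphism.Build _ _ padic_red padic_red_is_zmod_morphism)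
    (GRing.isMonoidMorphism.Build _ _ padic_red padic_red_is_monoid_morphism).

Lemma padic_residue_surj a : exists x, padic_residue x = a.
Proof. by exists (a : nat)%:R; rewrite rmorph_nat natr_Zp. Qed.

Lemma padic_red_eq0 x : padic_red x = 0 -> exists y, x = p%:R * y.
Proof.
move=> x0.
have px n : (p %| x n)%N.
  elim: n => [|n IHn].
    by move/eqP: x0; rewrite -(dvdn_pcharf (pchar_Fp p_pr)).
  have /eqP := padic_res_mod x n.
  move/(congr1 (modn^~ p)); rewrite !modn_dvdm ?dvdn_exp // => e.
  by rewrite /dvdn e; apply: IHn.
(* Division by [p] costs one digit: the quotient at level [n] is read off [x] at level [n.+1]. *)
have yP n : ((x n.+1 %/ p)%N%:R : 'Z_(p ^ n.+1))
            = (((x n.+2 %/ p)%N%:R : 'Z_(p ^ n.+2)) : nat)%:R.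
  rewrite -padic_natr; apply/eqP; rewrite padic_natr_eq eq_sym.
  rewrite -(eqn_pmul2l (prime_gt0 p_pr)) !muln_modr -expnS.
  by rewrite ![(p * (_ %/ p))%N]mulnC !divnK //; apply: padic_res_mod.
exists (PadicInt yP); apply: padic_eq => n.
rewrite -[RHS]/((p%:R : padic_int p) n * (x n.+1 %/ p)%N%:R) padic_natrE.
by rewrite -natrM mulnC divnK // -padic_resP.
Qed.

Lemma padic_red_unit x : padic_red x != 0 -> exists y, x * y = 1.
Proof.
move=> x0.
have px n : coprime (p ^ n.+1) (x n).
  rewrite coprime_pexpl // prime_coprime //.
  elim: n => [|n]; first by rewrite (dvdn_pcharf (pchar_Fp p_pr)).
  have /eqP := padic_res_mod x n.
  by move/(congr1 (modn^~ p)); rewrite !modn_dvdm ?dvdn_exp // /dvdn => ->.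
have xu n : x n \is a GRing.unit.
  by rewrite padic_res_natr unitZpE ?padic_expn_gt1.
have yP n : (x n)^-1 = ((x n.+1)^-1 : nat)%:R.
  apply: (mulrI (xu n)); rewrite divrr ?xu // [X in _ = X * _]padic_resP -natrM.
  rewrite -padic_natr_mod.
  have /(congr1 (@nat_of_ord _)) /= -> := divrr (xu n.+1).
  by [].
by exists (PadicInt yP); apply: padic_eq => n; exact: (divrr (xu n)).
Qed.

Lemma padic_dvdz (m : int) n :
  (exists z : padic_int p, m%:~R = p%:R ^+ n.+1 * z) <-> (p%:Z ^+ n.+1 %| m)%Z.
Proof.
split=> [[z /(congr1 (fun y : padic_int p => y n))]|/dvdzP [q ->]].
  rewrite padic_intrE -natrX -[RHS]/((_ : padic_int p) n * z n) padic_natrE.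
  have /eqP -> : ((p ^ n.+1)%:R : 'Z_(p ^ n.+1)) == 0.
    by rewrite padic_natr_eq0.
  rewrite mul0r => /eqP m0.
  rewrite -[p%:Z ^+ _]rmorphXn dvdzE /=.
  rewrite -padic_natr_eq0.
  by case: m m0 => k; rewrite ?NegzE ?mulrNz ?oppr_eq0 -?pmulrn ?abszN.
by exists q%:~R; rewrite rmorphM rmorphXn mulrC.
Qed.

End PadicFacts.

(** * Overrings *)

(** Carrying the law as data allows an overring to live on ['rV[R]_4] itself, where being a quartic
    ring is immediate. *)
Record bilinear_law (R : comNzRingType) (V : lmodType R) := BilinearLaw {
  law_mul : V -> V -> V;
  law_one : V;
  law_mulA : associative law_mul;
  law_mulC : commutative law_mul;
  law_mul1 : left_id law_one law_mul;
  law_mulDl : left_distributive law_mul +%R;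
  law_one_neq0 : law_one != 0;
  law_scaleAl : forall (a : R) u v, a *: law_mul u v = law_mul (a *: u) v
}.

(* An alias of [V] on which the law [m] is the canonical multiplication. *)
Definition law_alg (R : comNzRingType) (V : lmodType R) (m : bilinear_law V) :
  Type := V.

Section LawAlgebra.
Variables (R : comNzRingType) (V : lmodType R) (m : bilinear_law V).

HB.instance Definition _ := GRing.Lmodule.on (law_alg m).
HB.instance Definition _ := GRing.Zmodule_isComNzRing.Build (law_alg m)
  (@law_mulA R V m) (@law_mulC R V m) (@law_mul1 R V m) (@law_mulDl R V m)
  (law_one_neq0 m).
HB.instance Definition _ :=
  GRing.Lmodule_isLalgebra.Build R (law_alg m) (@law_scaleAl R V m).
HB.instance Definition _ := GRing.Lalgebra_isComAlgebra.Build R (law_alg m).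

End LawAlgebra.

Section Overring.
Variables (R : comNzRingType) (pi : R).

(** The image [M] of [g] contains [pi S], is not contained in it, and satisfies [M M <= pi M]; so
    [M / pi] is a ring properly containing [S]. Fractions are avoided by letting the vector [u]
    stand for [g u / pi]. *)
Lemma not_maximal_of_lattice (S : comAlgType R) (g : {linear 'rV[R]_4 -> S}) :
  (forall s : S, pi *: s = 0 -> s = 0) -> injective g ->
  (forall u v, exists w, g u * g v = pi *: g w) ->
  (forall s, exists u, g u = pi *: s) ->
  (exists u, forall s, g u <> pi *: s) ->
  ~ maximal_quartic_ring S.
Proof.
move=> regS g_inj gM gpi [u0 u0P] [_ maxS].
have piI (s t : S) : pi *: s = pi *: t -> s = t.
  move=> e; apply/eqP; rewrite -subr_eq0; apply/eqP; apply: regS.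
  by rewrite scalerBr e subrr.
have gpiI u v : pi *: g u = pi *: g v -> u = v by move=> /piI/g_inj.
have [mu muP] : exists mu, forall u v, g u * g v = pi *: g (mu u v).
  have /choice[m mP] : forall uv : 'rV[R]_4 * 'rV[R]_4,
      exists w, g uv.1 * g uv.2 = pi *: g w by move=> uv; apply: gM.
  by exists (fun u v => m (u, v)) => u v; apply: (mP (u, v)).
have /choice[h hP] := gpi.
have muA : associative mu.
  move=> u v w; apply: gpiI; rewrite -!muP; apply: piI.
  by rewrite scalerAr scalerAl -!muP mulrA.
have muC : commutative mu by move=> u v; apply: gpiI; rewrite -!muP mulrC.
have mu1 : left_id (h 1) mu.
  by move=> u; apply: gpiI; rewrite -muP hP -scalerAl mul1r.
have muD : left_distributive mu +%R.
  move=> u v w; apply: gpiI; rewrite -muP !linearD /= mulrDl !muP.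
  by rewrite -!scalerDr.
have mu10 : h 1 != 0.
  apply/eqP => h10; have := hP 1; rewrite h10 linear0 => /esym/regS/eqP.
  by rewrite oner_eq0.
have muZ (a : R) u v : a *: mu u v = mu (a *: u) v.
  by apply: gpiI; rewrite -muP !linearZ /= -scalerAl muP !scalerA
    mulrC.
pose T : comAlgType R := law_alg (BilinearLaw muA muC mu1 muD mu10 muZ).
have h_lin : linear (h : S -> T).
  move=> a s t; apply: g_inj; rewrite linearP hP /= !hP scalerDr !scalerA.
  by rewrite mulrC.
have hM : monoid_morphism (h : S -> T).
  split=> // s t; apply: gpiI; rewrite -[RHS]muP !hP -!scalerAl -!scalerAr.
  by [].
pose hz := GRing.isLinear.Build R S T *:%R h h_lin.
pose hm := GRing.isMonoidMorphism.Build S T h hM.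
pose f : {lrmorphism S -> T} := HB.pack h hz hm.
have f_inj : injective f.
  by move=> s t /(congr1 g); rewrite !hP; apply: piI.
have T4 : quartic_ring T by constructor; exists id => //; exists id.
have [h' _ fK] := maxS T f T4 f_inj.
by apply: (u0P (h' u0)); rewrite -hP; congr (g _); apply: esym (fK u0).
Qed.
End Overring.

Definition divides (R : comNzRingType) (a b : R) : Prop := exists c, b = a * c.

Section Divides.
Variables (R : comNzRingType) (a : R).
Implicit Types b c : R.

Lemma divides_mulr b c : divides a b -> divides a (b * c).
Proof. by case=> d ->; exists (d * c); rewrite mulrA. Qed.

Lemma divides_mull b c : divides a b -> divides a (c * b).
Proof. by rewrite mulrC; apply: divides_mulr. Qed.

Lemma divides_id : divides a a.
Proof. by exists 1; rewrite mulr1. Qed.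

Lemma divides0 : divides a 0.
Proof. by exists 0; rewrite mulr0. Qed.

Lemma dividesD b c : divides a b -> divides a c -> divides a (b + c).
Proof. by case=> x -> [y ->]; exists (x + y); rewrite mulrDr. Qed.

Lemma dividesN b : divides a b -> divides a (- b).
Proof. by case=> x ->; exists (- x); rewrite mulrN. Qed.

Lemma dividesB b c : divides a b -> divides a c -> divides a (b - c).
Proof. by move=> ab ac; apply: dividesD => //; apply: dividesN. Qed.

End Divides.

Section Enlarge.
Variables (R : comNzRingType) (pi : R).
Hypothesis pi_reg : forall x, pi * x = 0 -> x = 0.
Hypothesis pi_nunit : ~ divides pi 1.

Variables (S : comAlgType R).
Variables (E : {linear 'rV[R]_4 -> S}) (E' : {linear S -> 'rV[R]_4}).
Hypotheses (EK : cancel E E') (E'K : cancel E' E).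

Let e i : S := E (delta_mx 0 i).

(** The overring is spanned by [e i / pi] for [i] in [D] and by the other [e i]; the predicate [M]
    of the proof is [pi] times it. The last two hypotheses say that [S e_i] lies in [M] and that
    [e_i e_j] lies in [pi M], for [i] and [j] in [D]. *)
Lemma not_maximal_enlarge (D : pred 'I_4) (i0 : 'I_4) :
  D i0 ->
  (forall i s j, D i -> ~~ D j -> divides pi (E' (s * e i) 0 j)) ->
  (forall i j, D i -> D j -> exists u : 'rV[R]_4,
     (forall l, ~~ D l -> divides pi (u 0 l)) /\ e i * e j = pi *: E u) ->
  ~ maximal_quartic_ring S.
Proof.
move=> Di0 H1 H2.
pose M s := forall i, ~~ D i -> divides pi (E' s 0 i).
pose d : 'rV[R]_4 := \row_i (if D i then 1 else pi).
pose g : {linear 'rV[R]_4 -> S} := E \o mulmxr (diag_mx d).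
have gE u i : E' (g u) 0 i = u 0 i * d 0 i by rewrite /g /= EK mul_mx_diag mxE.
have regM (s : S) : pi *: s = 0 -> s = 0.
  move=> /(congr1 E') /rowP s0; apply: (can_inj E'K).
  apply/rowP => i; have := s0 i; rewrite linearZ linear0 !mxE; exact: pi_reg.
have MD s t : M s -> M t -> M (s + t).
  by move=> Ms Mt i Di; rewrite linearD mxE;
     apply: dividesD; [apply: Ms|apply: Mt].
have MZ (a : R) s : M s -> M (a *: s).
  by move=> Ms i Di; rewrite linearZ mxE; apply: divides_mull; apply: Ms.
have Mpi s : M (pi *: s).
  by move=> i _; rewrite linearZ mxE; apply/divides_mulr/divides_id.
have M0 : M 0 by move=> i _; rewrite linear0 mxE; apply: divides0.
have Mg u : M (g u).
  move=> i Di; rewrite gE mxE (negbTE Di); apply/divides_mull/divides_id.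
have gM z : M z -> exists u, z = g u.
  move=> Mz.
  have /choice[u uP] : forall i, exists c, E' z 0 i = c * d 0 i.
    move=> i; rewrite mxE; case: ifPn => [_|/Mz[c ->]].
      by exists (E' z 0 i); rewrite mulr1.
    by exists c; rewrite mulrC.
  exists (\row_i u i); apply: (can_inj E'K); apply/rowP => i.
  by rewrite gE uP mxE.
pose P s := exists z, M z /\ s = pi *: z.
have PD : forall s t, P s -> P t -> P (s + t).
  move=> _ _ [s [Ms ->]] [t [Mt ->]]; exists (s + t).
  by rewrite scalerDr; split=> //; apply: MD.
have P0 : P 0 by exists 0; rewrite scaler0.
have Esum s : s = \sum_i E' s 0 i *: e i.
  rewrite -[LHS]E'K {1}(matrix_sum_delta (E' s)) big_ord1 linear_sum.
  by apply: eq_bigr => i _; rewrite linearZ.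
have PM s t : M s -> M t -> P (s * t).
  move=> Ms Mt; rewrite (Esum s) (Esum t) mulr_suml.
  apply: (big_ind P) => // i _; rewrite mulr_sumr.
  apply: (big_ind P) => // j _; rewrite -scalerAl -scalerAr.
  have [Di|/Ms[a ->]] := boolP (D i); have [Dj|/Mt[b ->]] := boolP (D j).
  - have [u [Mu ->]] := H2 _ _ Di Dj; rewrite !scalerA.
    exists ((E' s 0 i * E' t 0 j) *: E u); split.
      by apply: MZ => l; rewrite EK; apply: Mu.
    by rewrite scalerA; congr (_ *: _); ring.
  - exists ((E' s 0 i * b) *: (e j * e i)); split;
      first by apply: MZ => l; apply: H1.
    by rewrite !scalerA [e j * _]mulrC; congr (_ *: _); ring.
  - exists ((a * E' t 0 j) *: (e i * e j)); split;
      first by apply: MZ => l; apply: H1.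
    by rewrite !scalerA; congr (_ *: _); ring.
  - exists (pi *: ((a * b) *: (e i * e j))); split; first exact: Mpi.
    by rewrite !scalerA; congr (_ *: _); ring.
apply: (@not_maximal_of_lattice R pi S g) => //.
- move=> u v /(congr1 E') /rowP uv; apply/rowP => i; have := uv i.
  rewrite !gE mxE; case: (D i); rewrite ?mulr1 // => /eqP.
  rewrite -subr_eq0 -mulrBl mulrC => /eqP/pi_reg/eqP.
  by rewrite subr_eq0 => /eqP.
- move=> u v; have [z [/gM[w ->] ->]] := PM _ _ (Mg u) (Mg v); by exists w.
- by move=> s; have [u] := gM _ (Mpi s); exists u.
- exists (delta_mx 0 i0) => s /(congr1 E') /rowP/(_ i0).
  rewrite gE linearZ !mxE !eqxx Di0 mulr1 => e1; apply: pi_nunit.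
  by exists (E' s 0 i0).
Qed.

End Enlarge.

Notation o1 := (lift ord0 ord0 : 'I_4).
Notation o2 := (lift ord0 (lift ord0 ord0) : 'I_4).
Notation o3 := (lift ord0 (lift ord0 (lift ord0 ord0)) : 'I_4).

Lemma ord4P (P : 'I_4 -> Prop) : P 0 -> P o1 -> P o2 -> P o3 -> forall i, P i.
Proof.
move=> P0 P1 P2 P3 [[|[|[|[|//]]]] lt_i].
- by rewrite (_ : Ordinal _ = 0) //; apply: val_inj.
- by rewrite (_ : Ordinal _ = o1) //; apply: val_inj.
- by rewrite (_ : Ordinal _ = o2) //; apply: val_inj.
- by rewrite (_ : Ordinal _ = o3) //; apply: val_inj.
Qed.

(** * Bases unitriangular over the [w_i], and products in coordinates *)

Section TriangularBasis.
Variables (R : comNzRingType) (F : binary_quartic R).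
Variables m02 m03 m12 m13 m23 : R.

(* The element with coordinates [u] on the basis [1], [w_1],           *)
(* [w_2 + m12 w_1 + m02], [w_3 + m23 w_2 + m13 w_1 + m03].             *)
Definition bq_tri (u : 'rV[R]_4) : bq_ring F :=
  \row_i [:: u 0 0 + m02 * u 0 o2 + m03 * u 0 o3;
             u 0 o1 + m12 * u 0 o2 + m13 * u 0 o3;
             u 0 o2 + m23 * u 0 o3; u 0 o3]`_i.

Definition bq_tri_inv (s : bq_ring F) : 'rV[R]_4 :=
  \row_i [:: s 0 0 - m02 * s 0 o2 + (m02 * m23 - m03) * s 0 o3;
             s 0 o1 - m12 * s 0 o2 + (m12 * m23 - m13) * s 0 o3;
             s 0 o2 - m23 * s 0 o3; s 0 o3]`_i.

Fact bq_tri_linear : linear bq_tri.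
Proof. by move=> a u v; apply/rowP; apply: ord4P; rewrite !mxE /=; ring. Qed.

Fact bq_tri_inv_linear : linear bq_tri_inv.
Proof. by move=> a u v; apply/rowP; apply: ord4P; rewrite !mxE /=; ring. Qed.

HB.instance Definition _ :=
  GRing.isLinear.Build R 'rV[R]_4 (bq_ring F) *:%R bq_tri bq_tri_linear.
HB.instance Definition _ :=
  GRing.isLinear.Build R (bq_ring F) 'rV[R]_4 *:%R bq_tri_inv bq_tri_inv_linear.

Lemma bq_triK : cancel bq_tri bq_tri_inv.
Proof. by move=> u; apply/rowP; apply: ord4P; rewrite !mxE /=; ring. Qed.

Lemma bq_tri_invK : cancel bq_tri_inv bq_tri.
Proof. by move=> u; apply/rowP; apply: ord4P; rewrite !mxE /=; ring. Qed.

End TriangularBasis.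

Section Coordinates.
Variables (R : comNzRingType) (F : binary_quartic R).
Implicit Types s t : bq_ring F.

Let a4 := bq4 F. Let a3 := bq3 F. Let a2 := bq2 F.
Let a1 := bq1 F. Let a0 := bq0 F.

Lemma bq_mulE0 s t : (s * t) 0 0 = s 0 0 * t 0 0
  - a0 * a4 * (s 0 o1 * t 0 o3 + s 0 o2 * t 0 o2 + s 0 o3 * t 0 o1)
  - a0 * a3 * (s 0 o2 * t 0 o3 + s 0 o3 * t 0 o2) - a0 * a2 * (s 0 o3 * t 0 o3).
Proof.
by rewrite bq_mulE !big_ord_recl !big_ord0 /= /a4 /a3 /a2 /a1 /a0; ring.
Qed.

Lemma bq_mulE1 s t : (s * t) 0 o1 = s 0 0 * t 0 o1 + s 0 o1 * t 0 0
  - a3 * (s 0 o1 * t 0 o1) - a2 * (s 0 o1 * t 0 o2 + s 0 o2 * t 0 o1)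
  - a1 * (s 0 o1 * t 0 o3 + s 0 o2 * t 0 o2 + s 0 o3 * t 0 o1)
  - a0 * (s 0 o2 * t 0 o3 + s 0 o3 * t 0 o2).
Proof.
by rewrite bq_mulE !big_ord_recl !big_ord0 /= /a4 /a3 /a2 /a1 /a0; ring.
Qed.

Lemma bq_mulE2 s t : (s * t) 0 o2 = s 0 0 * t 0 o2 + s 0 o2 * t 0 0
  + a4 * (s 0 o1 * t 0 o1) - a2 * (s 0 o2 * t 0 o2)
  - a1 * (s 0 o2 * t 0 o3 + s 0 o3 * t 0 o2) - a0 * (s 0 o3 * t 0 o3).
Proof.
by rewrite bq_mulE !big_ord_recl !big_ord0 /= /a4 /a3 /a2 /a1 /a0; ring.
Qed.

Lemma bq_mulE3 s t : (s * t) 0 o3 = s 0 0 * t 0 o3 + s 0 o3 * t 0 0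
  + a4 * (s 0 o1 * t 0 o2 + s 0 o2 * t 0 o1) + a3 * (s 0 o2 * t 0 o2)
  - a1 * (s 0 o3 * t 0 o3).
Proof.
by rewrite bq_mulE !big_ord_recl !big_ord0 /= /a4 /a3 /a2 /a1 /a0; ring.
Qed.

Definition bq_mulEs := (bq_mulE0, bq_mulE1, bq_mulE2, bq_mulE3).

Lemma bq_tri_delta m02 m03 m12 m13 m23 i :
  bq_tri F m02 m03 m12 m13 m23 (delta_mx 0 i) =
  \row_l (nth [::] [:: [:: 1; 0; 0; 0]; [:: 0; 1; 0; 0]; [:: m02; m12; 1; 0];
                       [:: m03; m13; m23; 1]] i)`_l.
Proof.
by apply/rowP; move: i; do 2!apply: ord4P;
  rewrite !mxE /= ?mulr1 ?mulr0 ?addr0 ?add0r.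
Qed.

End Coordinates.

(** * Explicit overrings of the ring of a quartic form *)

Section NotMaximal.
Variables (R : comNzRingType) (pi : R).
Hypothesis pi_reg : forall x, pi * x = 0 -> x = 0.
Hypothesis pi_nunit : ~ divides pi 1.

Lemma not_maximal_tri (F : binary_quartic R) m02 m03 m12 m13 m23
    (D : pred 'I_4) (i0 : 'I_4) :
  let E := bq_tri F m02 m03 m12 m13 m23 in
  let E' := bq_tri_inv (F := F) m02 m03 m12 m13 m23 in
  D i0 ->
  (forall i s j, D i -> ~~ D j ->
     divides pi (E' (s * E (delta_mx 0 i)) 0 j)) ->
  (forall i j, D i -> D j -> exists u : 'rV[R]_4,
     (forall l, ~~ D l -> divides pi (u 0 l)) /\
     E (delta_mx 0 i) * E (delta_mx 0 j) = pi *: E u) ->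
  ~ maximal_quartic_ring (bq_ring F : comAlgType R).
Proof.
move=> E E'; exact: (not_maximal_enlarge pi_reg pi_nunit
  (bq_triK F m02 m03 m12 m13 m23) (bq_tri_invK _ _ _ _ _)).
Qed.

End NotMaximal.

Section NotMaximal.
Variables (R : comNzRingType) (pi : R).
Hypothesis pi_reg : forall x, pi * x = 0 -> x = 0.
Hypothesis pi_nunit : ~ divides pi 1.

(* For [h = X^2 - r X + s], [F = h (bq4 F X^2 + m1 X + m0) + rho1 X + rho0].  *)
(* The overring is generated by [x = (bq4 F theta^2 + m1 theta + m0) / pi]    *)
(* and [theta x].                                                             *)
Lemma not_maximal_quadratic (F : binary_quartic R) (r s : R) :
  let m1 := bq3 F + r * bq4 F in
  let m0 := bq2 F + r * m1 - s * bq4 F in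
  divides pi (m1 + r * bq4 F) -> divides pi (m0 - s * bq4 F) ->
  divides (pi ^+ 2) (bq1 F + r * m0 - s * m1) ->
  divides (pi ^+ 2) (bq0 F - s * m0) ->
  ~ maximal_quartic_ring (bq_ring F : comAlgType R).
Proof.
case: F => a4 a3 a2 a1 a0 /=; set F := BinaryQuartic _ _ _ _ _.
move=> [d1 e1] [d0 e0] [c1 f1] [c0 f0].
set m1 := a3 + r * a4 in e1 e0 f1 f0 *.
set m0 := a2 + r * m1 - s * a4 in e0 f1 f0 *.
have a0E : a0 = pi ^+ 2 * c0 + s * m0 by rewrite -f0; ring.
have a1E : a1 = pi ^+ 2 * c1 - r * m0 + s * m1 by rewrite -f1; ring.
have a2E : a2 = m0 - r * m1 + s * a4 by rewrite /m0; ring.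
have a3E : a3 = m1 - r * a4 by rewrite /m1; ring.
have m0E : m0 = pi * d0 + s * a4 by rewrite -e0; ring.
have m1E : m1 = pi * d1 - r * a4 by rewrite -e1; ring.
pose k := c1 * m0 - m1 * c0.
pose E := bq_tri F m0 0 r (r ^+ 2 - s) r.
pose E' := bq_tri_inv (F := F) m0 0 r (r ^+ 2 - s) r.
have x0 (t : bq_ring F) : E' (t * E (delta_mx 0 o2)) 0 0
    = pi * (pi * (t 0 o3 * k - t 0 o2 * a4 * c0)).
  by rewrite /k /E bq_tri_delta mxE /= !bq_mulEs !mxE /= a0E a1E a2E a3E; ring.
have x1 (t : bq_ring F) : E' (t * E (delta_mx 0 o2)) 0 o1
    = pi * - (pi * (t 0 o2 * c1 + t 0 o3 * c0)).
  by rewrite /E bq_tri_delta mxE /= !bq_mulEs !mxE /= a0E a1E a2E a3E; ring.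
have y0 (t : bq_ring F) : E' (t * E (delta_mx 0 o3)) 0 0
    = pi * (pi * (t 0 o2 * k - t 0 o1 * a4 * c0)).
  by rewrite /k /E bq_tri_delta mxE /= !bq_mulEs !mxE /= a0E a1E a2E a3E; ring.
have y1 (t : bq_ring F) : E' (t * E (delta_mx 0 o3)) 0 o1
    = pi * - (pi * (t 0 o1 * c1 + t 0 o2 * c0)).
  by rewrite /E bq_tri_delta mxE /= !bq_mulEs !mxE /= a0E a1E a2E a3E; ring.
pose D (i : 'I_4) := (1 < i)%N.
(* With [x] and [y = theta x] the last two basis vectors, these follow from
   [x = a4 h(theta) + pi (d1 theta + d0)] and [h(theta) x = - pi^2 (c1 theta + c0)]. *)
have prods : [/\ E (delta_mx 0 o2) * E (delta_mx 0 o2) = 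
   pi *: E (\row_l [:: - (pi * (a4 * c0)); - (pi * c1); d0; d1]`_l),
   E (delta_mx 0 o2) * E (delta_mx 0 o3) = 
   pi *: E (\row_l [:: pi * (k - r * a4 * c0); - (pi * (r * c1 + c0));
       - (s * d1 + pi * c1); d0 + r * d1]`_l) &
   E (delta_mx 0 o3) * E (delta_mx 0 o3) = 
   pi *: E (\row_l [:: pi * (r * k - (r ^+ 2 - s) * a4 * c0);
     - (pi * ((r ^+ 2 - s) * c1 + r * c0)); 
     - (s * (d0 + r * d1) + pi * (r * c1 + c0)); 
     r * (d0 + r * d1) - s * d1 - pi * c1]`_l)].
  split; apply/rowP; apply: ord4P; rewrite /E !bq_tri_delta mxE /= ?bq_mulEs;
    rewrite !mxE /= ?a0E ?a1E ?a2E ?a3E /k ?m0E ?m1E; ring.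
have dpi (a : R) : divides pi (pi * a) by exists a.
have [xx xy yy] := prods.
apply: (@not_maximal_tri R pi pi_reg pi_nunit F
  m0 0 r (r ^+ 2 - s) r D o2) => //.
- move=> i t j; move: i j; do 2![apply: ord4P => //] => _ _;
    [rewrite x0|rewrite x1|rewrite y0|rewrite y1]; apply: dpi.
have Drow (a b c d : R) : divides pi a -> divides pi b ->
    forall l, ~~ D l -> divides pi ((\row_l [:: a; b; c; d]`_l : 'rV[R]_4) 0 l).
  by move=> ? ?; apply: ord4P => // _; rewrite mxE.
apply: ord4P => //; apply: ord4P => // _ _.
- by eexists; split; [|exact: xx]; apply: Drow => //; apply: dividesN.
- by eexists; split; [|exact: xy]; apply: Drow => //; apply: dividesN.
- eexists; split; [|by rewrite mulrC; exact: xy].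
  by apply: Drow => //; apply: dividesN.
- by eexists; split; [|exact: yy]; apply: Drow => //; apply: dividesN.
Qed.

End NotMaximal.

Section NotMaximal.
Variables (R : comNzRingType) (pi : R).
Hypothesis pi_reg : forall x, pi * x = 0 -> x = 0.
Hypothesis pi_nunit : ~ divides pi 1.

(** If [F = pi G], the [w_i] of [F] are [pi] times those of [G], so the ring of [G] is an
    overring. *)
Lemma not_maximal_content (F : binary_quartic R) :
  divides pi (bq4 F) -> divides pi (bq3 F) -> divides pi (bq2 F) ->
  divides pi (bq1 F) -> divides pi (bq0 F) ->
  ~ maximal_quartic_ring (bq_ring F : comAlgType R).
Proof.
case: F => a4 a3 a2 a1 a0 /= [c4 ->] [c3 ->] [c2 ->] [c1 ->] [c0 ->].
set F := BinaryQuartic _ _ _ _ _.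
pose G := BinaryQuartic c4 c3 c2 c1 c0.
apply: (@not_maximal_tri R pi pi_reg pi_nunit F
  0 0 0 0 0 (fun i => i != 0) o1) => //.
- move=> i s j + /negbNE/eqP ->; move: i; apply: ord4P => // _.
  + exists (- (s 0 o3 * c0 * (pi * c4))).
    rewrite ?mxE /= ?bq_mulEs ?bq_tri_delta ?mxE /=; ring.
  + exists (- (s 0 o2 * c0 * (pi * c4)) - s 0 o3 * c0 * (pi * c3)).
    by rewrite ?mxE /= ?bq_mulEs ?bq_tri_delta ?mxE /=; ring.
  + exists (- (s 0 o1 * c0 * (pi * c4)) - s 0 o2 * c0 * (pi * c3)
            - s 0 o3 * c0 * (pi * c2)).
    by rewrite ?mxE /= ?bq_mulEs ?bq_tri_delta ?mxE /=; ring.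
- move=> i j i0 j0.
  (* Among these structure constants those on [w_0] are quadratic in the coefficients and the others
     linear, whence the extra [pi] at [l = 0]. *)
  exists (\row_l ((nth [::] (nth [::] (bq_table G) i) j)`_l * pi ^+ (l == 0))).
  split=> [l /negbNE/eqP ->|].
    by rewrite mxE; apply/divides_mull/divides_id.
  apply/rowP; move: i j i0 j0.
  do 2![apply: ord4P => //] => _ _; apply: ord4P;
    rewrite !bq_tri_delta !bq_mulEs !mxE /= ?expr0 ?expr1; ring.
Qed.

(* The overring is generated by [(F(theta) - F(k)) / ((theta - k) pi)]. *)
Lemma not_maximal_linear (F : binary_quartic R) (k : R) :
  divides (pi ^+ 2) (bq_eval F k 1) ->
  divides pi (4 * bq4 F * k ^+ 3 + 3 * bq3 F * k ^+ 2 + 2 * bq2 F * k + bq1 F) ->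
  ~ maximal_quartic_ring (bq_ring F : comAlgType R).
Proof.
case: F => a4 a3 a2 a1 a0; rewrite /bq_eval /=; set F := BinaryQuartic _ _ _ _ _.
move=> [c Fk] [d F'k].
set b := a1 + k * a2 + k ^+ 2 * a3 + k ^+ 3 * a4.
have a1E : a1 = pi * d - (4 * a4 * k ^+ 3 + 3 * a3 * k ^+ 2 + 2 * a2 * k).
  by rewrite -F'k; ring.
have a0E : a0 = pi ^+ 2 * c - (a4 * k ^+ 4 + a3 * k ^+ 3 + a2 * k ^+ 2 + a1 * k).
  by rewrite -Fk; ring.
(* The last basis vector [x] satisfies [(theta - k) x = - F(k) = - pi^2 c], so [s x] differs from
   [s(k) x] by a multiple of [pi^2]; that error is [pi e s]. *)
pose e (s : bq_ring F) : 'rV[R]_4 := \row_l [:: - (pi * c) *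
     (s 0 o1 * a4 + s 0 o2 * (a4 * k + a3) + s 0 o3 * (a4 * k ^+ 2 + a3 * k + a2));
   - (pi * c) * (s 0 o2 + s 0 o3 * k); - (pi * c) * s 0 o3; 0]`_l.
have eP (s : bq_ring F) l : l != o3 ->
    bq_tri_inv 0 b 0 (k ^+ 2) k (s * bq_tri F 0 b 0 (k ^+ 2) k (delta_mx 0 o3)) 0 l
    = pi * e s 0 l.
  by rewrite /b; move: l; apply: ord4P => // _;
    rewrite ?mxE /= ?bq_mulEs ?bq_tri_delta ?mxE /= a0E a1E; ring.
apply: (@not_maximal_tri R pi pi_reg pi_nunit F
  0 b 0 (k ^+ 2) k (fun i => i == o3) o3) => //.
- by move=> i s j /eqP -> /(eP s) ->; exists (e s 0 j).
- move=> i j /eqP -> /eqP ->.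
  (* The value of [x] at [k] is [F'(k) = pi d], which accounts for the entry [d]. *)
  exists (e (bq_tri F 0 b 0 (k ^+ 2) k (delta_mx 0 o3)) + \row_l [:: 0; 0; 0; d]`_l).
  split.
    apply: ord4P => // _; rewrite !mxE /= addr0 mulNr -mulrA; apply/dividesN;
    apply/divides_mulr/divides_id.
  apply/rowP; apply: ord4P;
    rewrite !bq_tri_delta !bq_mulEs !mxE /= /b ?a0E ?a1E; ring.
Qed.
End NotMaximal.

(** * Maximality *)

(** What the argument keeps of [Z_p]: a local ring whose maximal ideal is generated by a regular
    element. *)
Record residue_map (R : comNzRingType) (pi : R) (k : fieldType)
    (red : {rmorphism R -> k}) : Prop := ResidueMap {
  residue_reg : forall x, pi * x = 0 -> x = 0;
  residue_surj : forall a, exists x, red x = a;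
  residue_ker : forall x, red x = 0 <-> divides pi x;
  residue_unit : forall x, red x != 0 -> divides x 1
}.

(** * Extensions of quartic rings, seen in the residue field *)

Section Extensions.
Variables (R : comNzRingType) (pi : R) (k : fieldType).
Variable red : {rmorphism R -> k}.
Hypothesis res : residue_map pi red.

Lemma residue_lift (I : Type) (a : I -> k) : exists x, forall i, red (x i) = a i.
Proof. by have /choice[x xP] := fun i => residue_surj res (a i); exists x. Qed.

Lemma quartic_ring_reg (T : comAlgType R) (t : T) :
  quartic_ring T -> pi *: t = 0 -> t = 0.
Proof.
case=> -[v v_lin v_bij].
pose vm := GRing.isLinear.Build R T 'rV[R]_4 *:%R v v_lin.
pose vl : {linear T -> 'rV[R]_4} := HB.pack v vm.
move=> /(congr1 vl)/rowP pt0; apply: (bij_inj v_bij).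
change (vl t = vl 0); rewrite linear0; apply/rowP => i; rewrite mxE.
by apply: (residue_reg res); have := pt0 i; rewrite linear0 linearZ !mxE.
Qed.

(** In bases [f] is a square matrix. If its determinant vanishes in the residue field, a vector in
    the kernel of the reduction lifts to [x]; otherwise the determinant is a unit and the adjugate
    inverts [f]. *)
Lemma extension_witness (S T : comAlgType R) (f : {linear S -> T}) :
  quartic_ring S -> quartic_ring T -> ~ bijective f ->
  exists x t, f x = pi *: t /\ forall y, x <> pi *: y.
Proof.
move=> [[v v_lin [v' vK v'K]]] [[w w_lin [w' wK w'K]]] f_nbij.
pose vl : {linear S -> 'rV[R]_4} :=
  HB.pack v (GRing.isLinear.Build R S 'rV[R]_4 *:%R v v_lin).
pose wl : {linear T -> 'rV[R]_4} :=
  HB.pack w (GRing.isLinear.Build R T 'rV[R]_4 *:%R w w_lin).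
have v'_lin : linear v'.
  move=> a x y; apply: (can_inj vK); rewrite v'K.
  by rewrite -[RHS]/(vl _) linearP /= !v'K.
pose v'l : {linear 'rV[R]_4 -> S} :=
  HB.pack v' (GRing.isLinear.Build R 'rV[R]_4 S *:%R v' v'_lin).
pose phi : {linear 'rV[R]_4 -> 'rV[R]_4} := wl \o f \o v'l.
pose P := lin1_mx phi.
have PE u : w (f (v' u)) = u *m P by rewrite mul_rV_lin1.
have [detP0|detP] := eqVneq (\det (map_mx red P)) 0.
  have /det0P[u u0 uP] : \det (map_mx red P) == 0 by rewrite detP0.
  have [x xP] := residue_lift (fun i => u 0 i).
  pose X : 'rV[R]_4 := \row_i x i.
  have Xu : map_mx red X = u by apply/rowP => i; rewrite !mxE.
  have /choice[t tP] i : divides pi ((X *m P) 0 i).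
    by apply/(residue_ker res); rewrite -Xu -map_mxM in uP;
       move/rowP/(_ i): uP; rewrite !mxE.
  exists (v' X), (w' (\row_i t i)); split.
    apply: (can_inj wK); rewrite PE -[RHS]/(wl _) linearZ /= w'K.
    by apply/rowP => i; rewrite tP !mxE.
  move=> y Xy; case/eqP: u0; rewrite -Xu -(v'K X) Xy -[v _]/(vl _) linearZ.
  apply/rowP => i; rewrite !mxE; apply/(residue_ker res).
  exact/divides_mulr/divides_id.
have [c c1] : divides (\det P) 1.
  by apply: (residue_unit res); rewrite -det_map_mx.
case: f_nbij; exists (fun t => v' (w t *m (c *: \adj P))) => [x|t].
  by rewrite -[x]vK PE -mulmxA -scalemxAr mul_mx_adj scale_scalar_mx mulrC -c1
             mulmx1.
apply: (can_inj wK); rewrite PE -mulmxA -scalemxAl mul_adj_mx.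
by rewrite scale_scalar_mx mulrC -c1 mulmx1.
Qed.

(** Cayley-Hamilton for multiplication by [t], applied to the vector of [1]. *)
Lemma quartic_ring_integral (T : comAlgType R) (t : T) :
  quartic_ring T -> exists c : 'I_4 -> R, t ^+ 4 = \sum_i c i *: t ^+ i.
Proof.
case=> -[w w_lin [w' wK w'K]].
pose wl : {linear T -> 'rV[R]_4} :=
  HB.pack w (GRing.isLinear.Build R T 'rV[R]_4 *:%R w w_lin).
have w'_lin : linear w'.
  move=> a x y; apply: (can_inj wK); rewrite w'K.
  by rewrite -[RHS]/(wl _) linearP /= !w'K.
pose w'l : {linear 'rV[R]_4 -> T} :=
  HB.pack w' (GRing.isLinear.Build R 'rV[R]_4 T *:%R w' w'_lin).
have phi_lin : linear (fun u => w (w' u * t)).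
  by move=> a x y; rewrite -[w' _]/(w'l _) linearP mulrDl -scalerAl;
     rewrite -[w _]/(wl _) linearP.
pose phi : {linear 'rV[R]_4 -> 'rV[R]_4} :=
  HB.pack (fun u => w (w' u * t)) (GRing.isLinear.Build R _ _ *:%R _ phi_lin).
pose A := lin1_mx phi.
have AE u (p : {poly R}) : u *m horner_mx A p = w (w' u * horner_alg t p).
  elim/poly_ind: p u => [|p c IHp] u.
    by rewrite !rmorph0 mulmx0 mulr0 -[RHS]/(wl _) linear0.
  rewrite !rmorphD !rmorphM /= horner_mx_X horner_mx_C horner_algX horner_algC.
  rewrite mulmxDr mulmxA IHp mul_rV_lin1 /= wK mul_mx_scalar mulrDr mulrA.
  rewrite -[RHS]/(wl _) linearD -scalerAr mulr1 linearZ /=.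
  by rewrite w'K.
have chi0 : horner_alg t (char_poly A) = 0.
  have := AE (w 1) (char_poly A); rewrite Cayley_Hamilton mulmx0 wK mul1r.
  by move=> /esym e; apply: (can_inj wK); rewrite e -[RHS]/(wl _) linear0.
have sz : size (char_poly A) = 5%N by rewrite size_char_poly.
have c4 : (char_poly A)`_4 = 1.
  by have /monicP := char_poly_monic A; rewrite /lead_coef sz.
exists (fun i => - (char_poly A)`_i); apply/eqP.
rewrite -subr_eq0 -sumrN; apply/eqP; rewrite -[RHS]chi0.
rewrite -[in RHS](coefK (char_poly A)) sz poly_def rmorph_sum [in RHS]big_ord_recr /= c4.
rewrite scale1r rmorphXn /= horner_algX addrC; congr (_ + _).
apply: eq_bigr => i _; rewrite scaleNr opprK.
by rewrite -mul_polyC rmorphM rmorphXn /= horner_algX horner_algC mulr_algl.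
Qed.

End Extensions.

(** * Irreducible factors over a field *)

Section PolyField.
Variable k : fieldType.
Implicit Types h p q : {poly k}.

Lemma irreducible_dvdpM h p q :
  irreducible_poly h -> h %| p * q -> (h %| p) || (h %| q).
Proof.
move=> h_irr; have [//|hp] := boolP (h %| p).
by rewrite Gauss_dvdpr // irreducible_poly_coprime.
Qed.

Lemma irreducible_dvdpX h p n : irreducible_poly h -> h %| p ^+ n -> h %| p.
Proof.
move=> h_irr; elim: n => [|n IHn]; last first.
  by rewrite exprS => /(irreducible_dvdpM h_irr)/orP[].
by rewrite expr0 dvdp1; case: h_irr => /[swap] _; case: (size h) => [|[]].
Qed.

Lemma exists_irreducible_factor p :
  (1 < size p)%N -> exists h, [/\ h \is monic, irreducible_poly h & h %| p].
Proof.
elim: (size p) {-2}p (leqnn (size p)) => [|n IHn] {}p.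
  by move=> le_p lt_p; have := leq_trans lt_p le_p.
move=> le_p lt1p.
have p0 : p != 0 by rewrite -size_poly_gt0 (ltn_trans _ lt1p).
have [p_irr|] := pselect (irreducible_poly p).
  exists ((lead_coef p)^-1 *: p); split.
  - by rewrite monicE lead_coefZ mulVf // lead_coef_eq0.
  - split=> [|q q1]; rewrite ?size_scale ?invr_eq0 ?lead_coef_eq0 //.
    rewrite dvdpZr ?invr_eq0 ?lead_coef_eq0 // => /(p_irr.2 _ q1) qp.
    by apply: eqp_trans qp _; rewrite eqp_sym eqp_scale // invr_eq0 lead_coef_eq0.
  - by rewrite dvdpZl ?invr_eq0 ?lead_coef_eq0.
move=> p_red; have [q [q1 qp nqp]] : exists q, [/\ size q != 1, q %| p & ~~ (q %= p)].
  have [//|nq] := pselect (exists q, [/\ size q != 1, q %| p & ~~ (q %= p)]).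
  case: p_red; split=> // q q1 qp; have [//|nqp] := boolP (q %= p).
  by case: nq; exists q.
have q0 : q != 0 by apply: contraNneq p0 => q0; rewrite q0 dvd0p in qp.
have [||h [h_m h_irr hq]] := IHn q.
- rewrite -ltnS (leq_trans _ le_p) // ltn_neqAle dvdp_leq // andbT.
  by rewrite (dvdp_size_eqp qp).
- by rewrite ltn_neqAle eq_sym q1 size_poly_gt0.
by exists h; split=> //; apply: dvdp_trans hq qp.
Qed.

Lemma irreducible_valuation h p : irreducible_poly h -> p != 0 ->
  exists e c, p = h ^+ e * c /\ ~~ (h %| c).
Proof.
move=> h_irr; elim: (size p) {-2}p (leqnn (size p)) => [|n IHn] {}p le_p p0.
  by case/negP: p0; rewrite -size_poly_leq0.
have [/dvdpP[q pE]|hp] := boolP (h %| p); last by exists 0, p; rewrite mul1r.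
have [q0 h0] : q != 0 /\ h != 0.
  by apply/andP; rewrite -negb_or -mulf_eq0 -pE.
have [||e [c [qE hc]]] := IHn q => //.
  rewrite -ltnS (leq_trans _ le_p) // pE size_mul //.
  have := h_irr.1; case: (size h) => [|[|m]] // _.
  by rewrite addnS /= addnS ltnS leq_addr.
by exists e.+1, c; rewrite pE qE exprSr mulrAC.
Qed.

End PolyField.

(** * Dedekind's criterion *)

Section Dedekind.
Variables (R : comNzRingType) (pi : R) (k : fieldType).
Variable red : {rmorphism R -> k}.
Hypothesis res : residue_map pi red.

Lemma map_poly_residue_surj (p : {poly k}) : exists P, map_poly red P = p.
Proof.
have [x xP] := residue_lift res (fun i => p`_i).
exists (\poly_(i < size p) x i); apply/polyP => i; rewrite coef_map coef_poly.
by case: ltnP => [_|le]; [apply: xP|rewrite nth_default // raddf0].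
Qed.

Lemma map_poly_residue_eq (P Q : {poly R}) :
  map_poly red P = map_poly red Q -> exists A, P = Q + pi *: A.
Proof.
move=> ePQ.
have /polyP PQ0 : map_poly red (P - Q) = 0 by rewrite rmorphB /= ePQ subrr.
have /choice[a aP] i : divides pi ((P - Q)`_i).
  by apply/(residue_ker res); have := PQ0 i; rewrite coef_map coef0.
exists (\poly_(i < size (P - Q)) a i); apply/polyP => i.
rewrite coefD coefZ coef_poly; case: ltnP => [_|le].
  by rewrite -aP coefB addrC subrK.
have := nth_default 0 le; rewrite coefB mulr0 addr0 => /eqP.
by rewrite subr_eq0 => /eqP.
Qed.

Variables (S T : comAlgType R) (f : {lrmorphism S -> T}).
Hypotheses (T4 : quartic_ring T) (f_inj : injective f).

Definition pi_part (x : S) : Prop := exists t, f x = pi *: t.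

Lemma pi_partM x y : pi_part x -> pi_part (x * y).
Proof. by case=> t xt; exists (t * f y); rewrite rmorphM /= xt scalerAl. Qed.

Lemma pi_partZ y : pi_part (pi *: y).
Proof. by exists (f y); rewrite linearZ. Qed.

Lemma pi_partD x y : pi_part x -> pi_part y -> pi_part (x + y).
Proof.
by case=> t xt [u yu]; exists (t + u); rewrite rmorphD /= xt yu scalerDr.
Qed.

(** From [f x = pi t] follows [pi f z = pi^2 t^2], and [pi] cancels in [T]. *)
Lemma pi_part_sqr x z : pi_part x -> x ^+ 2 = pi *: z -> pi_part z.
Proof.
case=> t xt xz; exists (t ^+ 2); apply/eqP; rewrite -subr_eq0; apply/eqP.
apply: (quartic_ring_reg res T4).
by rewrite scalerBr -linearZ /= -xz rmorphXn /= xt exprZn expr2 scalerA subrr.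
Qed.

(** If [f x = pi t], the quartic equation of [t] multiplied by [pi^4] becomes one for [x] whose
    lower coefficients are all divisible by [pi]. *)
Lemma pi_part_nilp x : pi_part x -> exists y, x ^+ 4 = pi *: y.
Proof.
case=> t xt; have [c tE] := quartic_ring_integral t T4.
exists (\sum_i (c i * pi ^+ (3 - i)) *: x ^+ i); apply: f_inj.
rewrite rmorphXn /= xt exprZn tE linearZ /= (linear_sum f) !scaler_sumr.
apply: eq_bigr => i _; rewrite (linearZ_LR f) rmorphXn /= xt exprZn !scalerA.
have -> : pi ^+ 4 = pi * (pi ^+ (3 - i) * pi ^+ i).
  by rewrite -exprD subnK -?exprS // -ltnS.
by congr (_ *: _); move: (pi ^+ (3 - i)) (pi ^+ i) => a b; ring.
Qed.

(** The conclusion puts [P] in the square of the ideal [(H, pi)]. Modulo [pi] the ideal of [x] is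
    generated by [g = gcd(g0, p)]; in a relation [P = Q G + pi W] with [G] lifting [g], an
    irreducible factor [h] of [p / g] divides each of [Q], [G] and [W] modulo [pi]. *)
Lemma dedekind (ev : {rmorphism {poly R} -> S}) (P : {poly R}) (x : S) :
  (forall c, ev c%:P = c%:A) -> ev P = 0 -> map_poly red P != 0 ->
  (forall s, exists G, s = ev G) ->
  (forall G s, ev G = pi *: s -> map_poly red P %| map_poly red G) ->
  pi_part x -> (forall y, x <> pi *: y) ->
  exists h, [/\ h \is monic, irreducible_poly h & forall H, map_poly red H = h ->
    exists a b c, P = H ^+ 2 * a + pi *: (H * b) + pi ^+ 2 *: c].
Proof.
set p := map_poly red P.
move=> evC evP p0 ev_surj ev_ker Jx x_npi.
have evZ (A : {poly R}) : ev (pi *: A) = pi *: ev A.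
  by rewrite -mul_polyC rmorphM evC mulr_algl.
have Jnilp G : pi_part (ev G) -> p %| map_poly red G ^+ 4.
  by case/pi_part_nilp => y; rewrite -rmorphXn /= => /ev_ker; rewrite rmorphXn.
have [G0 xE] := ev_surj x.
pose g0 := map_poly red G0.
have pg0 : ~~ (p %| g0).
  apply/negP => /dvdpP[q qE]; have [Q Qq] := map_poly_residue_surj q.
  have [|A AE] := @map_poly_residue_eq G0 (Q * P); first by rewrite rmorphM /= Qq.
  by apply: (x_npi (ev A)); rewrite xE AE rmorphD rmorphM /= evP mulr0 add0r evZ.
have [[u v] /= gE] := Bezoutp g0 p; set g := u * g0 + v * p in gE.
have gp : g %| p by rewrite (eqp_dvdl _ gE) dvdp_gcdr.
have npg : ~~ (p %| g).
  by apply: contra pg0 => /dvdp_trans-> //; rewrite (eqp_dvdl _ gE) dvdp_gcdl.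
have [U Uu] := map_poly_residue_surj u; have [V Vv] := map_poly_residue_surj v.
pose G := U * G0 + V * P.
have Gg : map_poly red G = g by rewrite rmorphD !rmorphM /= Uu Vv.
have JG : pi_part (ev G).
  by rewrite rmorphD !rmorphM /= evP mulr0 addr0 mulrC -xE; apply: pi_partM.
move: G Gg JG => G Gg JG.
have /dvdpP[q pE] := gp.
have [q0 g00] : q != 0 /\ g != 0 by apply/andP; rewrite -negb_or -mulf_eq0 -pE.
have lt1q : (1 < size q)%N.
  rewrite ltnNge; apply: contra npg => /size1_polyC qc.
  by rewrite pE qc mul_polyC dvdpZl // -polyC_eq0 -qc.
(* [h] is taken in the cofactor [q = p / g]; since [p] divides [g^4], it divides [g] as well. *)
have [h [h_m h_irr hq]] := exists_irreducible_factor lt1q.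
exists h; split=> // H Hh.
have hp : h %| p by rewrite pE dvdp_mulr.
have hg : h %| g.
  by apply: (irreducible_dvdpX (n := 4) h_irr);
     rewrite -Gg; apply: dvdp_trans hp (Jnilp G JG).
have /dvdpP[q1 qE] := hq; have /dvdpP[g1 g1E] := hg.
have [Q1 Q1q] := map_poly_residue_surj q1.
have [G1 G1g] := map_poly_residue_surj g1.
have [|A AE] := @map_poly_residue_eq G (G1 * H).
  by rewrite Gg rmorphM /= G1g Hh.
have [Q QE] : exists Q, Q = Q1 * H by exists (Q1 * H).
have [|W WE] := @map_poly_residue_eq P (Q * G).
  by rewrite -/p pE QE !rmorphM /= Q1q Hh Gg -qE.
have [t tE] := JG.
have fW : f (ev W) = - t * f (ev Q).
  apply/eqP; rewrite mulNr -subr_eq0 opprK; apply/eqP/(quartic_ring_reg res T4).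
  have e : f (ev Q * ev G + pi *: ev W) = 0.
    by rewrite -evZ -rmorphM -rmorphD -WE /= evP linear0.
  rewrite scalerDr scalerAl -tE -[RHS]e addrC mulrC.
  by rewrite linearD linearZ /= rmorphM.
(* [f (W theta) = - t Q(theta)] with [h %| q]: if [p = h^e c] then *)
(* [W^e c] lies in [J], hence is nilpotent modulo [pi].            *)
have hW : h %| map_poly red W.
  have [e [c [pc hc]]] := irreducible_valuation h_irr p0.
  have [C Cc] := map_poly_residue_surj c.
  have JWC : pi_part (ev (W ^+ e * C)).
    have [|B BE] := @map_poly_residue_eq (Q ^+ e * C) (Q1 ^+ e * P).
      rewrite QE !rmorphM !rmorphXn /= rmorphM /= Hh Cc -/p pc exprMn.
      by rewrite mulrA.
    exists ((- t) ^+ e * f (ev B)).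
    rewrite rmorphM rmorphXn rmorphM rmorphXn /= fW exprMn -mulrA.
    rewrite -!rmorphXn -!rmorphM /= BE rmorphD rmorphM /= evP mulr0 add0r evZ.
    by rewrite linearZ scalerAr.
  have := dvdp_trans hp (Jnilp _ JWC).
  move/(irreducible_dvdpX h_irr); rewrite rmorphM rmorphXn /= Cc.
  case/(irreducible_dvdpM h_irr)/orP; first exact: irreducible_dvdpX.
  by rewrite (negbTE hc).
have /dvdpP[w wE] := hW; have [W1 W1w] := map_poly_residue_surj w.
have [|B BE] := @map_poly_residue_eq W (W1 * H).
  by rewrite wE rmorphM /= W1w Hh.
exists (Q1 * G1), (Q1 * A + W1), B.
rewrite WE AE BE QE !scalerDr scalerA -expr2 -!mul_polyC; ring.
Qed.

End Dedekind.

Lemma bq_quartic_ring (R : comNzRingType) (F : binary_quartic R) :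
  quartic_ring (bq_ring F : comAlgType R).
Proof. by constructor; exists id => //; exists id. Qed.

(** * Maximality when the leading coefficient is a unit *)

Section Maximal.
Variables (R : comNzRingType) (pi : R) (k : fieldType).
Variable red : {rmorphism R -> k}.
Hypothesis res : residue_map pi red.

Lemma maximal_of_pi_part (S : comAlgType R) : quartic_ring S ->
  (forall (T : comAlgType R) (f : {lrmorphism S -> T}) x,
     quartic_ring T -> injective f -> pi_part pi f x -> exists y, x = pi *: y) ->
  maximal_quartic_ring S.
Proof.
move=> S4 H; split=> // T f T4 f_inj.
have [//|/(extension_witness res S4 T4)[x [t [xt x_npi]]]] := pselect (bijective f).
by have [|y xy] := H T f x T4 f_inj; [exists t|case: (x_npi y)].
Qed.

Definition bq_poly (F : binary_quartic R) : {poly R} :=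
  Poly [:: bq0 F; bq1 F; bq2 F; bq3 F; bq4 F].

Lemma bq_polyE F : bq_poly F = (bq4 F)%:P * 'X^4 + (bq3 F)%:P * 'X^3
  + (bq2 F)%:P * 'X^2 + (bq1 F)%:P * 'X + (bq0 F)%:P.
Proof. by rewrite /bq_poly /= !cons_poly_def; ring. Qed.

Lemma residue_cancel (a x : R) : divides a 1 -> red (a * x) = 0 -> red x = 0.
Proof.
case=> b ab; rewrite rmorphM => /eqP; rewrite mulf_eq0 => /orP[/eqP a0|/eqP //].
by have := oner_eq0 k; rewrite -(rmorph1 red) ab rmorphM a0 mul0r eqxx.
Qed.

Section LeadingUnit.
Variable F : binary_quartic R.
Hypothesis F4 : divides (bq4 F) 1.

Let w1 : bq_ring F := delta_mx 0 o1.
Let w2 : bq_ring F := delta_mx 0 o2.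
Let w3 : bq_ring F := delta_mx 0 o3.

Lemma bq_root : exists theta : bq_ring F,
  [/\ bq4 F *: theta = w1, theta * w1 = w2 - bq3 F *: theta,
      theta * w2 = w3 - bq2 F *: theta
    & theta * w3 = - (bq0 F)%:A - bq1 F *: theta].
Proof.
have [c c1] := F4; exists (c *: w1).
have c4 (a : R) : a * bq4 F * c = a by rewrite -mulrA -c1 mulr1.
pose simp := (mulr0, mul0r, mulr1, addr0, add0r, subr0, sub0r, oppr0).
split; first by rewrite scalerA -c1 scale1r.
- by apply/rowP; apply: ord4P; rewrite /w1 /w2 /w3 !bq_mulEs !mxE /= !simp -?c1.
- apply/rowP; apply: ord4P; rewrite /w1 /w2 /w3 !bq_mulEs !mxE /= !simp -?c1 //.
- by apply/rowP; apply: ord4P; rewrite /w1 /w2 /w3 !bq_mulEs !mxE /= !simp ?c4.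
Qed.

(** The ring is generated by [theta], and [h^2] divides a polynomial of degree 4, so [h] is linear
    or quadratic; each hypothesis excludes one degree. *)
Lemma maximal_of_dedekind :
  (forall a, ~ (divides (pi ^+ 2) (bq_eval F a 1) /\ 
     divides pi (4 * bq4 F * a ^+ 3 + 3 * bq3 F * a ^+ 2 + 2 * bq2 F * a + bq1 F))) ->
  (forall r s, let m1 := bq3 F + r * bq4 F in let m0 := bq2 F + r * m1 - s * bq4 F in
     ~ [/\ divides pi (m1 + r * bq4 F), divides pi (m0 - s * bq4 F),
          divides (pi ^+ 2) (bq1 F + r * m0 - s * m1) &
          divides (pi ^+ 2) (bq0 F - s * m0)]) ->
  maximal_quartic_ring (bq_ring F : comAlgType R).
Proof.
move=> no_lin no_quad; apply: (maximal_of_pi_part (bq_quartic_ring F)).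
move=> T f x T4 f_inj Jx.
have [//|x_npi] := pselect (exists y, x = pi *: y); exfalso.
have [theta [th1 th2 th3 th4]] := bq_root.
have [c c1] := F4.
have redF4 : red (bq4 F) != 0.
  apply/eqP => a0; have /eqP := rmorph1 red; rewrite c1 rmorphM a0 mul0r eq_sym.
  by rewrite oner_eq0.
have fld (a : R) : red (c * a) = 0 -> red a = 0.
  by apply: residue_cancel; exists (bq4 F); rewrite mulrC.
have evE (a : R) n : horner_alg theta (a%:P * 'X^n) = a *: theta ^+ n.
  by rewrite rmorphM rmorphXn /= horner_algC horner_algX mulr_algl.
have ev1 (a : R) : horner_alg theta (a%:P * 'X) = a *: theta.
  by rewrite -['X]expr1 evE.
have evP : horner_alg theta (bq_poly F) = 0.
  rewrite bq_polyE !rmorphD /= !evE ev1 horner_algC.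
  have -> : bq4 F *: theta ^+ 4 = theta * (theta * (theta * w1)).
    by rewrite -th1 -!scalerAr; congr (_ *: _); ring.
  rewrite th2 !mulrBr th3 mulrBr th4 -!scalerAr -!expr2 -exprS.
  by rewrite !subrK addNr.
have w2E : w2 = bq4 F *: theta ^+ 2 + bq3 F *: theta.
  by rewrite expr2 scalerAr th1 th2 subrK.
have w3E : w3 = bq4 F *: theta ^+ 3 + bq3 F *: theta ^+ 2 + bq2 F *: theta.
  rewrite -[LHS](subrK (bq2 F *: theta)) -th3 w2E mulrDr -!scalerAr -expr2.
  by rewrite -exprS.
have [|||||||h [h_m h_irr hP]] :=
  @dedekind R pi k red res _ T f T4 f_inj (horner_alg theta) (bq_poly F) x.
- exact: horner_algC.
- exact: evP.
- apply: contra_neq redF4 => /polyP/(_ 4%N).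
  by rewrite coef_map coef0 bq_polyE !coefD !coefCM !coefXn coefX coefC /=
             !mulr0 !addr0 mulr1.
- move=> s.
  exists ((s 0 0)%:P + (s 0 o1 * bq4 F)%:P * 'X
    + ((s 0 o2 * bq4 F)%:P * 'X^2 + (s 0 o2 * bq3 F)%:P * 'X)
    + ((s 0 o3 * bq4 F)%:P * 'X^3 + (s 0 o3 * bq3 F)%:P * 'X^2
      + (s 0 o3 * bq2 F)%:P * 'X)).
  rewrite !rmorphD /= !evE !ev1 horner_algC -!scalerA -!scalerDr -w3E -w2E th1.
  by apply/rowP; apply: ord4P; rewrite !mxE /=; ring.
- move=> G s evG.
  pose p := map_poly red (bq_poly F); set g := map_poly red G.
  have szp : (size p <= 5)%N.
    by rewrite (leq_trans (size_poly _ _)) // (leq_trans (size_Poly _)).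
  have p0 : p != 0.
    apply: contra_neq redF4 => /polyP/(_ 4%N).
    by rewrite coef_map coef0 bq_polyE !coefD !coefCM !coefXn coefX coefC /=
             !mulr0 !addr0 mulr1.
  have szr : (size (g %% p)%R <= 4)%N by rewrite -ltnS (leq_trans _ szp) // ltn_modp.
  have [b bP] := residue_lift res (fun i => (g %% p)`_i).
  have [Q Qq] := map_poly_residue_surj res (g %/ p).
  pose B := (b 0)%:P + (b 1)%:P * 'X + (b 2)%:P * 'X^2 + (b 3)%:P * 'X^3.
  have Br : map_poly red B = g %% p.
    apply/polyP => i.
    rewrite coef_map /B !coefD !coefCM !coefXn coefX coefC.
    case: i => [|[|[|[|i]]]]; rewrite /= ?mulr0 ?mulr1 ?addr0 ?add0r ?bP //.
    by rewrite raddf0 nth_default // (leq_trans szr).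
  have evB0 : horner_alg theta B = (b 0)%:A + b 1 *: theta + b 2 *: theta ^+ 2
      + b 3 *: theta ^+ 3.
    by rewrite /B !rmorphD /= !evE ev1 horner_algC.
  clearbody B.
  have [|A AE] := @map_poly_residue_eq R pi k red res G (Q * bq_poly F + B).
    by rewrite rmorphD rmorphM /= Qq Br -divp_eq.
  have evB : horner_alg theta B = pi *: (s - horner_alg theta A).
    rewrite scalerBr -evG AE !rmorphD rmorphM /= evP mulr0 add0r.
    by rewrite -mul_polyC rmorphM /= horner_algC mulr_algl addrK.
  (* [B] has degree at most 3 and [B(theta)] lies in [pi S]. The powers of [theta] are triangular on
     the [w_i] with units on the diagonal, so the coefficients of [B] vanish modulo [pi], from the
     top one down. *)
  suff B0 : map_poly red B = 0.
    by apply/modp_eq0P; rewrite -Br.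
  have thE : theta = c *: w1 by rewrite -th1 scalerA mulrC -c1 scale1r.
  have cK u : u = c *: (bq4 F *: u) by rewrite scalerA mulrC -c1 scale1r.
  have e2 : theta ^+ 2 = c *: (w2 - bq3 F *: theta).
    by rewrite [LHS]cK w2E addrK.
  have e3 : theta ^+ 3 = c *: (w3 - bq2 F *: theta - bq3 F *: theta ^+ 2).
    by rewrite [LHS]cK w3E !addrK.
  have D l : divides pi (((b 0)%:A + b 1 *: theta + b 2 *: theta ^+ 2
      + b 3 *: theta ^+ 3) 0 l).
    by exists ((s - horner_alg theta A) 0 l); rewrite -evB0 evB mxE.
  have b3 : red (b 3) = 0.
    apply/fld/(residue_ker res); have [d] := D o3.
    by rewrite e3 e2 thE !mxE /= => dE; exists d; rewrite -dE; ring.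
  have [b3' b3E] := (residue_ker res _).1 b3.
  have b2 : red (b 2) = 0.
    apply/fld/(residue_ker res); have [d] := D o2.
    rewrite e3 e2 thE !mxE /= b3E => dE; exists (d + c * bq3 F * c * b3').
    by rewrite mulrDr -dE; ring.
  have [b2' b2E] := (residue_ker res _).1 b2.
  have b1 : red (b 1) = 0.
    apply/fld/(residue_ker res); have [d] := D o1.
    rewrite e3 e2 thE !mxE /= b3E b2E => dE.
    exists (d + c * bq3 F * c * b2'
      + (c * bq2 F * c - c * bq3 F * (c * bq3 F * c)) * b3').
    by rewrite mulrDr mulrDr -dE; ring.
  have b0 : red (b 0) = 0.
    apply/(residue_ker res); have [d] := D 0.
    by rewrite e3 e2 thE !mxE /= => dE; exists d; rewrite -dE; ring.
  rewrite Br; apply/polyP => i; rewrite coef0.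
  by case: i => [|[|[|[|i]]]];
    [rewrite -bP|rewrite -bP|rewrite -bP|rewrite -bP|
     rewrite nth_default // (leq_trans szr)].
- exact: Jx.
- by move=> y xy; apply: x_npi; exists y.
pose p := map_poly red (bq_poly F).
have p4 : p`_4 = red (bq4 F).
  by rewrite coef_map bq_polyE !coefD !coefCM !coefXn coefX coefC /=
             !mulr0 !addr0 mulr1.
have szp : size p = 5%N.
  apply/eqP; rewrite eqn_leq (leq_trans (size_poly _ _)) /=;
    last by rewrite (leq_trans (size_Poly _)).
  by apply: contraNltn redF4 => szp; rewrite -p4 nth_default.
have redpi (A : {poly R}) : map_poly red (pi *: A) = 0.
  apply/polyP => i; rewrite coef_map coefZ coef0 /= rmorphM.
  by rewrite (residue_ker res pi).2 ?mul0r //; apply: divides_id.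
have szh : (size h <= 3)%N.
  have [H0 H0h] := map_poly_residue_surj res h.
  have [A [B [C pE]]] := hP _ H0h.
  have : h ^+ 2 %| p.
    rewrite /p pE [pi ^+ 2]expr2 -scalerA !rmorphD /= !redpi !addr0.
    by rewrite rmorphM rmorphXn /= H0h dvdp_mulr.
  move=> /dvdp_leq; rewrite -size_poly_gt0 szp => /(_ isT).
  have := size_exp h 2; have := h_irr.1.
  case: (size h) => [|n] // _; case: (size (h ^+ 2)) => [|m] /= e le5.
    by move: e; case: n => //.
  by rewrite ltnS -(leq_pmul2r (isT : 0 < 2)%N) -e.
have [lt3|ge3] := ltnP (size h) 3.
  have szh2 : size h = 2%N by apply/eqP; rewrite eqn_leq -ltnS lt3 h_irr.1.
  have [a0 a0h] := residue_surj res h`_0; pose a := - a0.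
  have [|A [B [C pE]]] := hP ('X - a%:P).
    apply/polyP => i; rewrite coef_map coefB coefX coefC /= rmorphB.
    case: i => [|[|i]] /=.
    - by rewrite rmorph0 sub0r -rmorphN /= opprK.
    - by rewrite rmorph1 rmorph0 subr0; have /monicP := h_m; rewrite /lead_coef szh2.
    - by rewrite !rmorph0 subr0 nth_default // szh2.
  apply: (no_lin a); split.
    exists C.[a]; have /(congr1 (horner^~ a)) := pE.
    rewrite bq_polyE !hornerE /= subrr => e.
    by rewrite /bq_eval; apply: etrans (etrans e _); ring.
  exists (B.[a] + pi * (C^`()).[a]).
  have /(congr1 (fun p => (p^`()).[a])) := pE.
  rewrite bq_polyE !derivE /= !hornerE /= subrr => e.
  by apply: etrans (etrans e _); ring.
have szh3 : size h = 3%N by apply/eqP; rewrite eqn_leq szh.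
have h2 : h`_2 = 1 by have /monicP := h_m; rewrite /lead_coef szh3.
have [r0 r0h] := residue_surj res h`_1; pose r := - r0.
have [s sh] := residue_surj res h`_0.
pose H := 'X^2 - r%:P * 'X + s%:P.
have HE i : H`_i = [:: s; - r; 1]`_i.
  rewrite /H !coefD coefN coefCM !coefXn coefX coefC.
  by case: i => [|[|[|i]]] /=; rewrite ?nth_nil; ring.
have Hh : map_poly red H = h.
  apply/polyP => i; rewrite coef_map HE.
  case: i => [|[|[|i]]] /=; rewrite ?h2 ?rmorph1 ?rmorphN ?opprK //.
  by rewrite nth_nil raddf0 nth_default // szh3.
have szH : size H = 3%N.
  apply/eqP; rewrite eqn_leq; apply/andP; split.
    by apply/leq_sizeP => i; rewrite HE;
       case: i => [|[|[|i]]]; rewrite //= nth_nil.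
  by rewrite ltnNge; apply/negP => /(nth_default 0) /eqP; rewrite HE /= oner_eq0.
have Hm : H \is monic by rewrite monicE /lead_coef szH HE.
have [A [B [C pE]]] := hP _ Hh.
pose m1 := bq3 F + r * bq4 F; pose m0 := bq2 F + r * m1 - s * bq4 F.
pose rho1 := bq1 F + r * m0 - s * m1; pose rho0 := bq0 F - s * m0.
pose M := (bq4 F)%:P * 'X^2 + m1%:P * 'X + m0%:P.
have ME i : M`_i = [:: m0; m1; bq4 F]`_i.
  rewrite /M !coefD !coefCM !coefXn coefX coefC.
  by case: i => [|[|[|i]]] /=; rewrite ?nth_nil; ring.
have FE : bq_poly F = H * M + (rho1%:P * 'X + rho0%:P).
  by rewrite bq_polyE /H /M /rho1 /rho0 /m0 /m1; ring.
(* Once [C] is divided by the monic [H], uniqueness of division identifies the two expressions of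
   [F]: the quotients agree ([N = 0]), and [rho1 X + rho0] is [pi^2 E]. *)
pose C1 := Pdiv.Ring.rdivp C H; pose E := Pdiv.Ring.rmodp C H.
have CE : C = C1 * H + E by rewrite [LHS](Pdiv.RingMonic.rdivp_eq Hm).
have szE : (size E <= 2)%N.
  by rewrite -ltnS -szH Pdiv.Ring.ltn_rmodpN0 // monic_neq0.
pose N := M - H * A - pi *: B - pi ^+ 2 *: C1.
have HN : H * N = pi ^+ 2 *: E - (rho1%:P * 'X + rho0%:P).
  have := pE; rewrite CE FE /N -!mul_polyC => e.
  apply/eqP; rewrite -subr_eq0 -(subrr (H * M + (rho1%:P * 'X + rho0%:P))) {2}e.
  by apply/eqP; ring.
have N0 : N = 0.
  apply/eqP; apply: contraT => N0; have := size_monicM Hm N0.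
  rewrite HN szH => sz.
  have : (size (pi ^+ 2 *: E - (rho1%:P * 'X + rho0%:P))%R <= 2)%N.
    apply/leq_sizeP => i i2; rewrite !coefD !coefN !coefD coefZ coefCM coefX coefC.
    rewrite nth_default ?(leq_trans szE) //.
    by case: i i2 => [|[|i]] //= _; ring.
  by rewrite sz; move: N0; rewrite -size_poly_gt0; case: (size N).
have EE i : pi ^+ 2 * E`_i = (rho1%:P * 'X + rho0%:P)`_i.
  by have /eqP := HN; rewrite N0 mulr0 eq_sym subr_eq0 => /eqP <-; rewrite coefZ.
have ME2 : map_poly red M = h * map_poly red A.
  move: N0 => /(congr1 (map_poly red)); rewrite /N [pi ^+ 2]expr2 -scalerA.
  rewrite !rmorphB /= !redpi !subr0 rmorph0 rmorphM /= Hh => /eqP.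
  by rewrite subr_eq0 => /eqP.
have szM : size (map_poly red M) = 3%N.
  apply/eqP; rewrite eqn_leq; apply/andP; split.
    apply/leq_sizeP => i; rewrite coef_map ME.
    by case: i => [|[|[|i]]] //= _; rewrite nth_nil raddf0.
  rewrite ltnNge; apply/negP => /(nth_default 0); rewrite coef_map ME /=.
  by move/eqP: redF4.
have [alpha A1] : exists alpha, map_poly red A = alpha%:P.
  exists (map_poly red A)`_0; apply: size1_polyC.
  have A0 : map_poly red A != 0.
    by apply/eqP => A0; move: szM; rewrite ME2 A0 mulr0 size_poly0.
  have := size_monicM h_m A0; rewrite -ME2 szM szh3 => /eqP.
  by rewrite eqSS => /eqP [] <-.
have hM i : red M`_i = h`_i * alpha by rewrite -coef_map ME2 A1 coefMC.
have alphaE : alpha = red (bq4 F) by have := hM 2%N; rewrite ME h2 mul1r.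
apply: (no_quad r s); split.
- apply/(residue_ker res); change (red (m1 + r * bq4 F) = 0).
  have := hM 1%N; rewrite ME /= => m1E.
  by rewrite rmorphD m1E /r !(rmorphN, rmorphM) alphaE -r0h; ring.
- apply/(residue_ker res); change (red (m0 - s * bq4 F) = 0).
  have := hM 0%N; rewrite ME /= => m0E.
  by rewrite rmorphB m0E rmorphM alphaE -sh; ring.
- by exists E`_1; rewrite EE coefD coefCM coefX coefC /= mulr1 addr0.
- by exists E`_0; rewrite EE coefD coefCM coefX coefC /= mulr0 add0r.
Qed.

End LeadingUnit.
End Maximal.

Lemma maximal_transfer (R : comNzRingType) (S S' : comAlgType R)
    (phi : {lrmorphism S' -> S}) :
  bijective phi -> quartic_ring S ->
  maximal_quartic_ring S' -> maximal_quartic_ring S.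
Proof.
move=> phi_bij S4 [_ maxS']; split=> // T f T4 f_inj.
have [psi phiK psiK] := phi_bij.
have [|g gK Kg] := maxS' T (f \o phi) T4.
  by apply: inj_comp => //; apply: bij_inj.
exists (phi \o g) => [x|t] /=; last exact: Kg.
by rewrite -{1}[x]psiK -[f _]/((f \o phi) _) gK psiK.
Qed.

(** * The substitution [(x, y) -> (x + y, x)] *)

Section Shift.
Variables (R : comNzRingType) (F : binary_quartic R).

Let a4 := bq4 F. Let a3 := bq3 F. Let a2 := bq2 F.
Let a1 := bq1 F. Let a0 := bq0 F.

(** This is [F(x + y, x)], with leading coefficient [F(1, 1)]. *)
Definition bq_shift : binary_quartic R :=
  BinaryQuartic (a4 + a3 + a2 + a1 + a0) (4 * a4 + 3 * a3 + 2 * a2 + a1)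
                (6 * a4 + 3 * a3 + a2) (4 * a4 + a3) a4.

(* [theta' = 1 / (theta - 1)] is a root of [bq_shift F]; the coefficient of *)
(* [u 0 i] below is the [w_i] of [theta'], on those of [theta].             *)
Definition bq_shift_map (u : bq_ring bq_shift) : bq_ring F :=
  \row_i [:: u 0 0 - (a1 + a2 + a3 + a4) * u 0 o1
             - (3 * a4 + 2 * a3 + a2) * u 0 o2 - (3 * a4 + a3) * u 0 o3;
             - u 0 o1 - 2 * u 0 o2 - u 0 o3; - u 0 o1 - u 0 o2; - u 0 o1]`_i.

Definition bq_shift_inv (s : bq_ring F) : bq_ring bq_shift :=
  \row_i [:: s 0 0 - (a1 + a2 + a3 + a4) * s 0 o3
             + (3 * a4 + 2 * a3 + a2) * (s 0 o3 - s 0 o2)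
             + (3 * a4 + a3) * (2 * s 0 o2 - s 0 o1 - s 0 o3);
             - s 0 o3; s 0 o3 - s 0 o2; 2 * s 0 o2 - s 0 o1 - s 0 o3]`_i.

Lemma bq_shift_bij : bijective bq_shift_map.
Proof.
by exists bq_shift_inv => x; apply/rowP; apply: ord4P; rewrite !mxE /=; ring.
Qed.

Fact bq_shift_linear : linear bq_shift_map.
Proof. by move=> a u v; apply/rowP; apply: ord4P; rewrite !mxE /=; ring. Qed.

Fact bq_shift_monoid_morphism : monoid_morphism bq_shift_map.
Proof.
split=> [|u v]; apply/rowP; apply: ord4P.
1-4: by rewrite !mxE /=; ring.
all: rewrite !bq_mulEs !mxE !bq_mulEs /= /a4 /a3 /a2 /a1 /a0; ring.
Qed.

HB.instance Definition _ := GRing.isLinear.Build R (bq_ring bq_shift)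
  (bq_ring F) *:%R bq_shift_map bq_shift_linear.
HB.instance Definition _ := GRing.isMonoidMorphism.Build (bq_ring bq_shift)
  (bq_ring F) bq_shift_map bq_shift_monoid_morphism.

Lemma maximal_shift :
  maximal_quartic_ring (bq_ring bq_shift : comAlgType R) ->
  maximal_quartic_ring (bq_ring F : comAlgType R).
Proof.
exact: (maximal_transfer bq_shift_bij (bq_quartic_ring F)).
Qed.

End Shift.

(** * Residue points given by the roots of the form *)

Section Points.
Variables (R : comNzRingType) (pi : R) (k : fieldType).
Variable red : {rmorphism R -> k}.
Hypothesis res : residue_map pi red.
Variables (F : binary_quartic R) (T : comAlgType R).
Variable f : {lrmorphism (bq_ring F : comAlgType R) -> T}.
Hypotheses (T4 : quartic_ring T) (f_inj : injective f).

Let redpi y : red (pi * y) = 0.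
Proof. by apply/(residue_ker res); exists y. Qed.

(** Evaluation at a root is multiplicative into a field, so it kills whatever is nilpotent modulo
    [pi]. *)
Lemma pi_part_val t x : bq_eval (map_bq red F) t 1 = 0 ->
  pi_part pi f x -> bq_ring_val red t x = 0.
Proof.
move=> Ft0 /(pi_part_nilp T4 f_inj)[y x4].
have y0 : bq_ring_val red t (pi *: y : bq_ring F) = 0.
  by rewrite /bq_ring_val !mxE !redpi !mul0r !addr0.
have := bq_ring_valM Ft0 (x ^+ 2) (x ^+ 2).
rewrite -exprD x4 y0 expr2 (bq_ring_valM Ft0) => /esym/eqP.
by rewrite !mulf_eq0 !orbb => /eqP.
Qed.

(** Evaluation at the root at infinity when [a4] reduces to 0: by [F(theta, 1) = 0], the elements
    [w_1, w_2, w_3] tend to [- a3, - a2, - a1] as [1 / theta] tends to 0. *)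
Definition bq_val_inf (x : bq_ring F) : k :=
  red (x 0 0) - red (bq3 F) * red (x 0 o1) - red (bq2 F) * red (x 0 o2)
  - red (bq1 F) * red (x 0 o3).

Lemma bq_val_infM : red (bq4 F) = 0 -> {morph bq_val_inf : x y / x * y}.
Proof.
move=> a4 x y; rewrite /bq_val_inf !bq_mulEs.
by rewrite !(rmorphD, rmorphN, rmorphM) /= a4; ring.
Qed.

Lemma pi_part_val_inf x : red (bq4 F) = 0 ->
  pi_part pi f x -> bq_val_inf x = 0.
Proof.
move=> a4 /(pi_part_nilp T4 f_inj)[y x4].
have y0 : bq_val_inf (pi *: y) = 0.
  by rewrite /bq_val_inf !mxE !redpi !mulr0 !subr0.
have := bq_val_infM a4 (x ^+ 2) (x ^+ 2).
rewrite -exprD x4 y0 expr2 (bq_val_infM a4) => /esym/eqP.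
by rewrite !mulf_eq0 !orbb => /eqP.
Qed.

End Points.

(** * The case where [A] and [C] vanish in the residue field *)

Section Degenerate.
Variables (R : comNzRingType) (pi : R) (k : fieldType).
Variable red : {rmorphism R -> k}.
Hypothesis res : residue_map pi red.

(** If 2 is a unit, vanishing at the four distinct roots 0, 1, -1 and infinity leaves only [pi S].
    At 2 the roots 1 and -1 merge and the class of [y = w_1 + w_2 + w_3] survives; but [y^2 = 2 z],
    so [z] would have to vanish at 1 too, which makes [C] divisible by 4. *)
Lemma maximal_degenerate (A B C : R) :
  red A = 0 -> red C = 0 -> red B != 0 ->
  red 2 != 0 \/ (pi = 2 /\ ~ divides (pi ^+ 2) C) ->
  maximal_quartic_ring
    (bq_ring (BinaryQuartic A B (C - 2 * A) (- B) A) : comAlgType R).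
Proof.
set F := BinaryQuartic _ _ _ _ _ => A0 C0 B0 hyp2.
apply: (maximal_of_pi_part res (bq_quartic_ring F)) => T f x T4 f_inj Jx.
have C2A : red (C - 2 * A) = 0 by rewrite rmorphB rmorphM A0 C0 mulr0 subr0.
have root t : t ^+ 3 = t -> bq_eval (map_bq red F) t 1 = 0.
  by move=> t3; rewrite /bq_eval /= rmorphN A0 C2A t3; ring.
have vals y : pi_part pi f y -> [/\ red (y 0 0) = 0, red (y 0 o3) = red (y 0 o1),
    red (y 0 o2) + red (y 0 o3) = 0 & red (y 0 o3) - red (y 0 o2) = 0].
  move=> Jy.
  have e0 : bq_ring_val red 0 y = red (y 0 0).
    by rewrite /bq_ring_val /=; ring.
  have e1 : bq_ring_val red 1 y = red (y 0 0)
      + red B * (red (y 0 o2) + red (y 0 o3)).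
    by rewrite /bq_ring_val /= A0 C2A; ring.
  have e2 : bq_ring_val red (-1) y = red (y 0 0)
      + red B * (red (y 0 o3) - red (y 0 o2)).
    by rewrite /bq_ring_val /= A0 C2A; ring.
  have e3 : bq_val_inf red y = red (y 0 0)
      + red B * (red (y 0 o3) - red (y 0 o1)).
    by rewrite /bq_val_inf /= rmorphN C2A; ring.
  have y0 : red (y 0 0) = 0.
    by rewrite -e0 (pi_part_val res T4 f_inj) //; apply: root; rewrite expr0n.
  move: e1 e2 e3; rewrite (pi_part_val_inf res T4 f_inj) //.
  rewrite !(pi_part_val res T4 f_inj) //; try by apply: root; ring.
  rewrite y0 !add0r => /esym/eqP + /esym/eqP + /esym/eqP.
  rewrite !mulf_eq0 (negbTE B0) /= => /eqP e1 /eqP e2.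
  by rewrite subr_eq0 => /eqP e3.
have divs (y : bq_ring F) : red (y 0 0) = 0 -> red (y 0 o1) = 0 ->
    red (y 0 o2) = 0 -> red (y 0 o3) = 0 -> exists z : bq_ring F, y = pi *: z.
  move=> /(residue_ker res)[z0 y0] /(residue_ker res)[z1 y1].
  move=> /(residue_ker res)[z2 y2] /(residue_ker res)[z3 y3].
  exists (\row_i [:: z0; z1; z2; z3]`_i).
  by apply/rowP; apply: ord4P; rewrite !mxE.
have [x0 x31 x23 x32] := vals x Jx.
have x3 : red 2 * red (x 0 o3) = 0.
  rewrite -[RHS](addr0 0) -{1}x23 -x32 rmorph_nat; ring.
have [x3_0|x3_n0] := eqVneq (red (x 0 o3)) 0.
  apply: divs => //; first by rewrite -x31.
  by move: x23; rewrite x3_0 addr0.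
case: hyp2 => [two|[pi2 C4]].
  by move/eqP: x3; rewrite mulf_eq0 (negbTE two) (negbTE x3_n0).
exfalso.
have two : red 2 = 0 by rewrite -pi2; apply/(residue_ker res)/divides_id.
have x2 : red (x 0 o2) = red (x 0 o3).
  by move/eqP: x32; rewrite subr_eq0 => /eqP.
have [[A1 A1E] [C1 C1E]] := ((residue_ker res _).1 A0, (residue_ker res _).1 C0).
have C1n0 : red C1 != 0.
  apply/eqP => /(residue_ker res)[C2 C2E]; apply: C4; exists C2.
  by rewrite C1E C2E mulrA.
pose y : bq_ring F := \row_i [:: 0; 1; 1; 1]`_i.
have [c cx] := residue_unit res x3_n0.
have Jy : pi_part pi f y.
  have [||||z zE] := divs (y - c *: x).
  - by rewrite !mxE /= rmorphB rmorphM x0 mulr0 subr0 rmorph0.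
  - by rewrite !mxE /= rmorphB rmorphM -x31 -rmorphM mulrC -cx subrr.
  - by rewrite !mxE /= rmorphB rmorphM x2 -rmorphM mulrC -cx subrr.
  - by rewrite !mxE /= rmorphB -[c * _]mulrC -cx subrr.
  rewrite -(subrK (c *: x) y) zE; apply: pi_partD; first exact: pi_partZ.
  by rewrite -mulr_algl mulrC; apply: pi_partM.
pose z : bq_ring F := \row_i [:: - (2 * A1 ^+ 2 + 2 * A1 * B + 2 * A1 * C1);
  A + B - C; A + B - C1; A + B]`_i.
have yz : y ^+ 2 = pi *: z.
  rewrite expr2; apply/rowP; apply: ord4P;
  by rewrite ?mxE !bq_mulEs !mxE /= ?A1E ?C1E ?pi2; ring.
have [z0 z31 z23 z32] := vals z (pi_part_sqr res T4 Jy yz).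
move: z23; rewrite !mxE /= rmorphB !rmorphD A0 add0r => /eqP.
have -> : red B - red C1 + red B = red 2 * red B - red C1.
  by rewrite rmorph_nat; ring.
by rewrite two mul0r sub0r oppr_eq0 (negbTE C1n0).
Qed.
End Degenerate.

(** * The family A (x^2 - y^2)^2 + B x y (x^2 - y^2) + C x^2 y^2 *)

Section Valuation.
Variables (R : comNzRingType) (pi : R) (k : fieldType).
Variable red : {rmorphism R -> k}.
Hypothesis res : residue_map pi red.

Lemma residue_dividesM x y : divides pi (x * y) -> divides pi x \/ divides pi y.
Proof.
move=> /(residue_ker res)/eqP; rewrite rmorphM mulf_eq0.
by case/orP=> /eqP/(residue_ker res); [left|right].
Qed.

Lemma residue_divides_sqr x : divides pi (x ^+ 2) -> divides pi x.
Proof. by rewrite expr2 => /residue_dividesM[]. Qed.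

Lemma residue_ndivides x : red x != 0 <-> ~ divides pi x.
Proof.
split=> [/eqP xn0 /(residue_ker res)//|npx].
by apply/eqP => /(residue_ker res).
Qed.

Lemma divides_unitM n u x :
  red u != 0 -> divides (pi ^+ n) (u * x) -> divides (pi ^+ n) x.
Proof.
move=> /(residue_unit res)[c uc] [d ux]; exists (c * d).
by rewrite -[x]mul1r uc mulrAC ux; ring.
Qed.

Lemma divides_piM n x : divides (pi ^+ n.+1) (pi * x) -> divides (pi ^+ n) x.
Proof.
case=> c e; exists c; apply/eqP; rewrite -subr_eq0; apply/eqP.
by apply: (residue_reg res); rewrite mulrBr e exprS mulrA subrr.
Qed.

Lemma divides_expS n x : divides (pi ^+ n.+1) x -> divides (pi ^+ n) x.
Proof. by case=> c ->; exists (pi * c); rewrite exprSr mulrA. Qed.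

Lemma residue_nunit : ~ divides pi 1.
Proof. by apply/residue_ndivides; rewrite rmorph1 oner_eq0. Qed.

Lemma not_divides_1p e : red (1 - pi * e) != 0.
Proof.
apply/residue_ndivides => d; apply: residue_nunit.
by rewrite -(subrK (pi * e) 1); apply: dividesD => //; exists e.
Qed.

End Valuation.

(** * Maximality criteria for the family *)

Section Family.
Variables (R : comNzRingType) (pi : R) (k : fieldType).
Variable red : {rmorphism R -> k}.
Hypothesis res : residue_map pi red.
Variables A B C : R.

Let F := BinaryQuartic A B (C - 2 * A) (- B) A.
Let D := B ^+ 2 - 4 * A * C.
Let E := (4 * A - C) ^+ 2 + 4 * B ^+ 2.
Let pi_reg := residue_reg res.
Let pi_nunit := residue_nunit res.

(** Here [h = X^2 - r X - 1] is the fibre [u = r v], and [q] equals [A (u - r v)^2 + (B + 2 A r) (u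
    - r v) v + q(r, 1) v^2]. *)
Lemma family_not_maximal_quadratic r :
  divides pi (B + 2 * A * r) -> divides (pi ^+ 2) (A * r ^+ 2 + B * r + C) ->
  ~ maximal_quartic_ring (bq_ring F : comAlgType R).
Proof.
move=> d1 d2; apply: (not_maximal_quadratic (r := r) (s := -1) pi_reg pi_nunit).
- by move: d1; congr divides; rewrite /=; ring.
- by have /= := divides_expS (n := 1) d2; congr divides; rewrite /=; ring.
- by have := divides_mull r d2; congr divides; rewrite /=; ring.
- by move: d2; congr divides; rewrite /=; ring.
Qed.

(* By the chain rule, [2 a P + b Q] and [a Q - 2 b P] are the partial *)
(* derivatives of [F] at [(a, b)].                                    *)
Definition family_singular (a b : R) : Prop :=
  let u := a ^+ 2 - b ^+ 2 in let v := a * b in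
  let P := 2 * A * u + B * v in let Q := B * u + 2 * C * v in
  [/\ divides pi (2 * a * P + b * Q), divides pi (a * Q - 2 * b * P)
    & divides (pi ^+ 2) (A * u ^+ 2 + B * u * v + C * v ^+ 2)].

(** Dedekind's criterion is applied to [F] if [A] is a unit, and otherwise, if [C] is a unit, to
    [bq_shift F], whose leading coefficient is [C]. In the latter case a quadratic [h] has root 0
    modulo [pi], which is what the third hypothesis excludes. *)
Lemma family_maximal :
  (forall a b, ~ (divides pi a /\ divides pi b) -> ~ family_singular a b) ->
  (red A != 0 -> forall r s, divides pi (s - 1) \/ divides pi (s + 1) ->
    let m1 := B + r * A in let m0 := C - 2 * A + r * m1 - s * A in
     ~ [/\ divides pi (m1 + r * A), divides pi (m0 - s * A),
          divides (pi ^+ 2) (- B + r * m0 - s * m1) &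
          divides (pi ^+ 2) (A - s * m0)]) ->
  (red C != 0 -> divides pi B -> ~ divides (pi ^+ 2) A) ->
  (red A = 0 -> red C = 0 -> maximal_quartic_ring (bq_ring F : comAlgType R)) ->
  maximal_quartic_ring (bq_ring F : comAlgType R).
Proof.
move=> no_sing no_quad shift degen.
have [A0|A0] := eqVneq (red A) 0; last first.
  apply: (maximal_of_dedekind res); first exact: (residue_unit res).
    move=> a [d1 d2]; apply: (@no_sing a 1) => [[_]|]; first exact: pi_nunit.
    have d1' := divides_expS (n := 1) d1; rewrite expr1 in d1'.
    split.
    - by move: d2; congr divides; rewrite /=; ring.
    - have := dividesB (divides_mull 4 d1') (divides_mull a d2).
      by congr divides; rewrite /bq_eval /=; ring.
    - by move: d1; congr divides; rewrite /bq_eval /=; ring.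
  move=> r s m1 m0 [e1 e0 f1 f0]; apply: (no_quad A0 r s) => //.
  (* Eliminating [m0] between [e0] and [f0] gives [A (s^2 - 1) = 0] modulo [pi]. *)
  have : divides pi ((s - 1) * (s + 1)).
    apply: (divides_unitM res (n := 1) (u := A)) => //; rewrite expr1.
    have := dividesB (dividesN (divides_expS (n := 1) f0)) (divides_mull s e0).
    by congr divides; rewrite /=; ring.
  exact: (residue_dividesM res).
have [C0|C0] := eqVneq (red C) 0; first exact: degen.
apply: maximal_shift; apply: (maximal_of_dedekind res).
- by rewrite /= (_ : _ + A = C); [apply: (residue_unit res)|ring].
- move=> a [d1 d2]; apply: (@no_sing (a + 1) a) => [[a1 a0]|].
    by apply: pi_nunit; rewrite -(addrK a 1) [1 + a]addrC; apply: dividesB.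
  have d1' := divides_expS (n := 1) d1; rewrite expr1 in d1'.
  split.
  - have := dividesB (divides_mull 4 d1') (divides_mull a d2).
    by congr divides; rewrite /bq_eval /=; ring.
  - have := dividesB (divides_mull (a + 1) d2) (divides_mull 4 d1').
    by congr divides; rewrite /bq_eval /=; ring.
  - by move: d1; congr divides; rewrite /bq_eval /=; ring.
- have C4 : bq4 (bq_shift F) = C by rewrite /=; ring.
  move=> r s m1 m0 [e1 e0 f1 f0].
  have Adiv : divides pi A by apply/(residue_ker res).
  (* The shifted form has constant coefficient [A], so the same elimination gives [s^2 C = A = 0]
     modulo [pi]. *)
  have [sigma sE] : divides pi s.
    apply: (residue_divides_sqr res).
    apply: (divides_unitM res (n := 1) (u := C)) => //; rewrite expr1.
    have := dividesB (dividesB Adiv (divides_mull s e0))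
                     (divides_expS (n := 1) f0).
    by rewrite C4; congr divides; rewrite /=; ring.
  have [mu m0E] : divides pi m0.
    rewrite -(subrK (s * bq4 (bq_shift F)) m0); apply: dividesD => //.
    by apply: divides_mulr; exists sigma.
  apply: (shift C0).
    have : divides pi (- (r * m0) + s * m1 - 4 * A).
      apply: dividesB; last exact: divides_mull.
      apply: dividesD; first by apply/dividesN/divides_mull; exists mu.
      by apply: divides_mulr; exists sigma.
    move=> /(dividesD (divides_expS (n := 1) f1)).
    by congr divides; rewrite /=; ring.
  have [c f0E] := f0; exists (c + sigma * mu).
  by rewrite mulrDr -f0E /= m0E sE; ring.
Qed.

(** With [q0 = A r^2 + B r + C] one has [A - s m0 = A (1 + s)^2 - s q0], and [s] is a unit. *)
Lemma family_quadratic_neg r s :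
  let m1 := B + r * A in let m0 := C - 2 * A + r * m1 - s * A in
  divides pi (s + 1) -> divides (pi ^+ 2) (A - s * m0) ->
  divides (pi ^+ 2) (A * r ^+ 2 + B * r + C).
Proof.
move=> m1 m0 [e sE] [c f0].
apply: (divides_unitM res (u := 1 - pi * e)); first exact: not_divides_1p.
have {}sE : s = pi * e - 1 by rewrite -sE addrK.
exists (c - e ^+ 2 * A); rewrite mulrBr -f0 /m0 /m1 sE; ring.
Qed.

(* If [kk ^+ 2 = -1] then [u / v = 2 kk] at [(kk, 1)], a root of [u^2 + 4 v^2]. *)
Lemma family_not_maximal_sqrtN1 kk : 4 * A - C = 2 * B * kk ->
  divides pi (kk ^+ 2 + 1) ->
  divides (pi ^+ 2) (A * (kk ^+ 2 + 1) ^+ 2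
    + (B * kk - (4 * A - C)) * (kk ^+ 2 + 1)) ->
  ~ maximal_quartic_ring (bq_ring F : comAlgType R).
Proof.
move=> G d1 d2; have CE : C = 4 * A - 2 * B * kk by rewrite -G; ring.
apply: (not_maximal_linear (k := kk) pi_reg pi_nunit).
  by move: d2; congr divides; rewrite /bq_eval /= CE; ring.
have := divides_mull (4 * A * kk - B) d1.
by congr divides; rewrite /= CE; ring.
Qed.

Lemma family_maximal_iff_odd : red 2 != 0 ->
  maximal_quartic_ring (bq_ring F : comAlgType R) <->
  [/\ ~ [/\ divides pi A, divides pi B & divides pi C],
      ~ divides (pi ^+ 2) D,
      divides pi (4 * A - C) /\ divides pi B -> ~ divides (pi ^+ 3) E
    & ~ (divides pi (4 * A - C) /\ divides pi B) -> ~ divides (pi ^+ 2) E].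
Proof.
move=> two.
have four : red 4 != 0 by rewrite (_ : 4 = 2 * 2) ?rmorphM ?mulf_neq0 //; ring.
split=> [maxF|[content discD disc3 disc2]].
  have content : ~ [/\ divides pi A, divides pi B & divides pi C].
    move=> [dA dB dC]; apply: (not_maximal_content pi_reg pi_nunit) maxF => //=.
      by apply: dividesB => //; apply: divides_mull.
    exact: dividesN.
  split=> //.
  - move=> dD; have [A0|A0] := eqVneq (red A) 0; last first.
      have [c c1] : divides (2 * A) 1.
        by apply: (residue_unit res); rewrite rmorphM mulf_neq0.
      (* [r = - B / (2 A)] is the double root of [q], and [4 A q(r, 1) = - D]. *)
      apply: (@family_not_maximal_quadratic (- (B * c))) => //.
        have -> : B + 2 * A * - (B * c) = B * (1 - 2 * A * c) by ring.
        by rewrite -c1 subrr mulr0; apply: divides0.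
      apply: (divides_unitM res (u := 4 * A)); first by rewrite rmorphM mulf_neq0.
      have -> : 4 * A * (A * (- (B * c)) ^+ 2 + B * - (B * c) + C)
         = B ^+ 2 * (1 - 2 * A * c) ^+ 2 - D by rewrite /D; ring.
      by rewrite -c1 subrr expr0n mulr0 sub0r; apply: dividesN.
    have dA : divides pi A by apply/(residue_ker res).
    have dB : divides pi B.
      apply: (residue_divides_sqr res); rewrite -(subrK (4 * A * C) (B ^+ 2)).
      apply: dividesD; first exact: (divides_expS (n := 1) dD).
      by apply/divides_mulr/divides_mull.
    have C0 : red C != 0 by apply/(residue_ndivides res) => dC; apply: content.
    apply: (not_maximal_linear (k := 0) pi_reg pi_nunit) maxF.
      apply: (divides_unitM res (u := 4 * C)); first by rewrite rmorphM mulf_neq0.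
      have -> : 4 * C * bq_eval F 0 1 = B ^+ 2 - D by rewrite /bq_eval /D /=; ring.
      by apply: dividesB => //; case: dB => b ->; exists (b ^+ 2); ring.
    by move: (dividesN dB); congr divides; rewrite /=; ring.
  - move=> [[c GE] [b BE]] dE.
    have dcb : divides pi (c ^+ 2 + 4 * b ^+ 2).
      apply: (divides_piM res (n := 1)); apply: (divides_piM res (n := 2)).
      by move: dE; congr divides; rewrite /E GE BE; ring.
    have [b0|b0] := eqVneq (red b) 0.
      have [b' b'E] := (residue_ker res _).1 b0.
      have [c' c'E] : divides pi c.
        apply: (residue_divides_sqr res); rewrite -(addrK (4 * b ^+ 2) (c ^+ 2)).
        by apply: dividesB => //; exists (4 * b' * b); rewrite b'E; ring.
      have CE : C = 4 * A - pi ^+ 2 * c'.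
        by rewrite expr2 -mulrA -c'E -GE; ring.
      (* Here [F = A (x^2 + y^2)^2] modulo [pi^2], so [H = X^2 + 1]. *)
      apply: (not_maximal_quadratic (r := 0) (s := 1) pi_reg pi_nunit) maxF => /=.
      + by exists b; rewrite BE; ring.
      + by exists (- c); rewrite CE c'E; ring.
      + by exists (- (2 * b')); rewrite BE b'E; ring.
      + by exists c'; rewrite CE; ring.
    have [e be1] : divides (2 * b) 1.
      by apply: (residue_unit res); rewrite rmorphM mulf_neq0.
    have [kk cE] : exists kk, c = 2 * b * kk.
      by exists (e * c); rewrite mulrA -be1 mul1r.
    have d1 : divides pi (kk ^+ 2 + 1).
      apply: (divides_unitM res (n := 1) (u := 4 * b ^+ 2)).
        by rewrite rmorphM rmorphXn mulf_neq0 // expf_neq0.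
      by rewrite expr1; move: dcb; congr divides; rewrite cE; ring.
    apply: (family_not_maximal_sqrtN1 (kk := kk)) maxF => //.
      by rewrite GE BE cE; ring.
    have [eta d1E] := d1; exists (A * eta ^+ 2 + (b * kk - c) * eta).
    by rewrite GE BE d1E; ring.
  - move=> nboth dE.
    have B0 : red B != 0.
      apply/(residue_ndivides res) => dB; apply: nboth; split=> //.
      apply: (residue_divides_sqr res); rewrite -(addrK (4 * B ^+ 2) (_ ^+ 2)).
      apply: dividesB; first exact: (divides_expS (n := 1) dE).
      by rewrite expr2; apply/divides_mull/divides_mulr.
    have [e be1] : divides (2 * B) 1.
      by apply: (residue_unit res); rewrite rmorphM mulf_neq0.
    have [kk GE] : exists kk, 4 * A - C = 2 * B * kk.
      by exists (e * (4 * A - C)); rewrite [RHS]mulrA -be1 mul1r.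
    have d2 : divides (pi ^+ 2) (kk ^+ 2 + 1).
      apply: (divides_unitM res (u := 4 * B ^+ 2)).
        by rewrite rmorphM rmorphXn mulf_neq0 // expf_neq0.
      by move: dE; congr divides; rewrite /E GE; ring.
    apply: (family_not_maximal_sqrtN1 (kk := kk)) maxF => //.
      exact: (divides_expS (n := 1) d2).
    by apply: dividesD; [rewrite expr2|]; apply/divides_mull=> //; apply/divides_mull.
apply: family_maximal => [a b nab||C0 dB dA|A0 C0]; last 1 first.
- apply: (maximal_degenerate res) => //; last by left.
  apply/(residue_ndivides res) => dB; apply: content.
  by split=> //; apply/(residue_ker res).
- rewrite /family_singular; set u := a ^+ 2 - b ^+ 2; set v := a * b.
  set P := 2 * A * u + B * v; set Q := B * u + 2 * C * v => -[dP dQ df].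
  (* Off the branch locus the chain rule can be inverted, so [P] and [Q] vanish modulo [pi]; then
     [P^2 - 4 A q = v^2 D] and [Q^2 - 4 C q = u^2 D] make [D] divisible by [pi^2]. *)
  have [eps0|eps0] := eqVneq (red (a ^+ 2 + b ^+ 2)) 0; last first.
    have dP' : divides pi P.
      apply: (divides_unitM res (n := 1) (u := 2 * (a ^+ 2 + b ^+ 2))).
        by rewrite rmorphM mulf_neq0.
      rewrite expr1; have := dividesB (divides_mull a dP) (divides_mull b dQ).
      by congr divides; ring.
    have dQ' : divides pi Q.
      apply: (divides_unitM res (n := 1) (u := a ^+ 2 + b ^+ 2)) => //.
      rewrite expr1; have := dividesD (divides_mull b dP) (divides_mull a dQ).
      by congr divides; ring.
    apply: discD; have [v0|v0] := eqVneq (red v) 0; last first.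
      apply: (divides_unitM res (u := v ^+ 2)); first by rewrite rmorphXn expf_neq0.
      have [p pE] := dP'.
      have : divides (pi ^+ 2) (P ^+ 2) by exists (p ^+ 2); rewrite pE; ring.
      move/(fun h => dividesB h (divides_mull (4 * A) df)).
      by congr divides; rewrite /D /P; ring.
    apply: (divides_unitM res (u := u ^+ 2)).
      rewrite rmorphXn expf_neq0 //; apply/eqP => u0; apply: nab.
      have uE : u = a ^+ 2 - b ^+ 2 by [].
      move/(residue_ker res): u0 => u0; rewrite uE in u0.
      have /(residue_dividesM res)[da|db] := (residue_ker res _).1 v0.
        split=> //; apply: (residue_divides_sqr res).
        rewrite -(subKr (a ^+ 2) (b ^+ 2)); apply: dividesB => //.
        by rewrite expr2; apply: divides_mulr.
      split=> //; apply: (residue_divides_sqr res).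
      rewrite -(subrK (b ^+ 2) (a ^+ 2)); apply: dividesD => //.
      by rewrite expr2; apply: divides_mulr.
    have [q qE] := dQ'.
    have : divides (pi ^+ 2) (Q ^+ 2) by exists (q ^+ 2); rewrite qE; ring.
    move/(fun h => dividesB h (divides_mull (4 * C) df)).
    by congr divides; rewrite /D /Q; ring.
  have [eta etaE] := (residue_ker res _).1 eps0.
  have dab : divides pi a <-> divides pi b.
    have sq x y : x ^+ 2 + y ^+ 2 = pi * eta -> divides pi x -> divides pi y.
      move=> xy [z xE]; apply: (residue_divides_sqr res).
      by exists (eta - z * x); rewrite mulrBr -xy xE; ring.
    by split; apply: sq; rewrite // addrC.
  have v0 : red v != 0.
    apply/(residue_ndivides res) => /(residue_dividesM res)[] d; apply: nab;
    by split=> //; apply/dab.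
  have uv : u ^+ 2 + 4 * v ^+ 2 = pi ^+ 2 * eta ^+ 2.
    by rewrite -exprMn -etaE /u /v; ring.
  (* On the branch locus [u^2 = - 4 v^2] modulo [pi^2], so [q(u, v)] becomes
     [v (B u - (4 A - C) v)]. *)
  have [h hE] : divides (pi ^+ 2) (B * u - (4 * A - C) * v).
    apply: (divides_unitM res (u := v)) => //.
    have [c cE] := df; exists (c - A * eta ^+ 2).
    by rewrite [RHS]mulrBr -cE [pi ^+ 2 * (A * _)]mulrCA -uv; ring.
  have vE : v ^+ 2 * E = B ^+ 2 * (pi ^+ 2 * eta ^+ 2)
      - 2 * B * u * (pi ^+ 2 * h) + (pi ^+ 2 * h) ^+ 2.
    by rewrite -uv -hE /E; ring.
  have v20 : red (v ^+ 2) != 0 by rewrite rmorphXn expf_neq0.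
  (* If [pi] divides [B], every term of [vE] gains a further factor [pi]. *)
  have [both|nboth] := pselect (divides pi (4 * A - C) /\ divides pi B).
    apply: (disc3 both); apply: (divides_unitM res v20).
    have [_ [beta BE]] := both.
    exists (pi * beta ^+ 2 * eta ^+ 2 - 2 * beta * u * h + pi * h ^+ 2).
    by rewrite vE BE; ring.
  apply: (disc2 nboth); apply: (divides_unitM res v20).
  exists (B ^+ 2 * eta ^+ 2 - 2 * B * u * h + pi ^+ 2 * h ^+ 2).
  by rewrite vE; ring.
- move=> A0 r s [s1|s1] m1 m0 [e1 e0 f1 f0]; last first.
    (* This uses [D = (B + 2 A r)^2 - 4 A q(r, 1)]. *)
    apply: discD; have := family_quadratic_neg s1 f0.
    case=> c cE; have [d dE] := e1; exists (d ^+ 2 - 4 * A * c).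
    rewrite [RHS](_ : _ = (pi * d) ^+ 2 - 4 * A * (pi ^+ 2 * c)); last by ring.
    by rewrite -dE -cE /D /m1; ring.
  (* For [s = 1] modulo [pi] the congruences force [h = X^2 + 1] modulo [pi], and then [pi^2]
     divides both [B] and [4 A - C]. *)
  have dr : divides pi r.
    apply: (divides_unitM res (n := 1) (u := 4 * A)).
      by rewrite rmorphM mulf_neq0.
    rewrite expr1; have := dividesB (dividesB (dividesD
      (divides_expS (n := 1) f1) (divides_mulr (1 + s) e1))
      (divides_mull r e0)) (divides_mull (2 * r * A) s1).
    by congr divides; rewrite /m0 /m1; ring.
  have sn : red s = 1.
    apply/eqP; rewrite -subr_eq0 -(rmorph1 red) -rmorphB; apply/eqP.
    exact/(residue_ker res).
  have [eps epsE] := s1; have [eta rE] := dr; have [d0 d0E] := e0.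
  have [c1 c1E] := f1; have [c0 c0E] := f0.
  have [beta BE] : divides (pi ^+ 2) B.
    apply: (divides_unitM res (u := 1 + s)).
      by rewrite rmorphD rmorph1 sn -[1 + 1]/2%:R -(rmorph_nat red).
    exists (eta * d0 - c1); rewrite [RHS]mulrBr -c1E.
    rewrite (_ : pi ^+ 2 * (eta * d0) = r * (m0 - s * A)); last first.
      by rewrite d0E rE; ring.
    by rewrite /m1; ring.
  have [g gE] : divides (pi ^+ 2) (4 * A - C).
    apply: (divides_unitM res (u := s)); first by rewrite sn oner_eq0.
    exists (c0 - A * eps ^+ 2 + s * eta * (pi * beta + eta * A)).
    rewrite [RHS]mulrDr [pi ^+ 2 * (c0 - _)]mulrBr -c0E.
    rewrite (_ : pi ^+ 2 * (A * eps ^+ 2) = A * (s - 1) ^+ 2); last first.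
      by rewrite epsE; ring.
    by rewrite /m0 /m1 rE BE; ring.
  apply: disc3.
    by split; [exists (pi * g); rewrite gE|exists (pi * beta); rewrite BE]; ring.
  by exists (pi * (g ^+ 2 + 4 * beta ^+ 2)); rewrite /E gE BE; ring.
- apply: discD; have [b BE] := dB; apply: dividesB.
    by exists (b ^+ 2); rewrite BE; ring.
  by apply/divides_mulr/divides_mull.
Qed.

(** The points [(0 : 1)] and [(1 : 0)] account for the condition on [A], and [(1 : 1)] for that on
    [C]. As 1 and -1 agree modulo 2, every quadratic [h] is a fibre [u = r v]; [r = 0] concerns [C]
    and [r = 1] concerns [A - B + C]. *)
Lemma family_maximal_iff_two : pi = 2 -> (forall x : k, x = 0 \/ x = 1) ->
  maximal_quartic_ring (bq_ring F : comAlgType R) <->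
  [/\ ~ [/\ divides pi A, divides pi B & divides pi C],
      ~ divides (pi ^+ 2) C
    & ~ divides pi C -> divides pi B ->
      ~ divides (pi ^+ 2) A /\ ~ divides (pi ^+ 2) (A - B + C)].
Proof.
move=> pi2 k2.
have d2 x : divides pi (2 * x) by exists x; rewrite pi2.
split=> [maxF|[content C4 AC4]].
  split.
  - move=> [dA dB dC]; apply: (not_maximal_content pi_reg pi_nunit) maxF => //=.
      by apply: dividesB => //; apply: divides_mull.
    exact: dividesN.
  - move=> C4; apply: (not_maximal_linear (k := 1) pi_reg pi_nunit) maxF.
      by move: C4; congr divides; rewrite /bq_eval /=; ring.
    by have := d2 (B + C); congr divides; rewrite /=; ring.
  - move=> _ dB; split=> d.
      apply: (not_maximal_linear (k := 0) pi_reg pi_nunit) maxF.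
        by move: d; congr divides; rewrite /bq_eval /=; ring.
      by move: (dividesN dB); congr divides; rewrite /=; ring.
    apply: (family_not_maximal_quadratic (r := 1)) maxF.
      by have := dividesD dB (d2 A); congr divides; ring.
    have [b BE] := dB; have : divides (pi ^+ 2) (2 * B).
      by exists b; rewrite BE pi2; ring.
    by move/(dividesD d); congr divides; ring.
have C4' : red C != 0 -> divides pi B -> ~ divides (pi ^+ 2) A.
  by move=> /(residue_ndivides res) dC dB; case: (AC4 dC dB).
apply: family_maximal => [a b nab||//|A0 C0]; last 1 first.
- apply: (maximal_degenerate res) => //; last by right.
  apply/(residue_ndivides res) => dB; apply: content.
  by split=> //; apply/(residue_ker res).
- rewrite /family_singular; set u := a ^+ 2 - b ^+ 2; set v := a * b.
  set P := 2 * A * u + B * v; set Q := B * u + 2 * C * v => -[dP dQ df].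
  have ndiv x : red x = 1 -> red x != 0 by move=> ->; apply: oner_neq0.
  have dBu : divides pi (B * u).
    have dbQ : divides pi (b * Q).
      by have := dividesB dP (d2 (a * P)); congr divides; ring.
    have daQ : divides pi (a * Q).
      by have := dividesD dQ (d2 (b * P)); congr divides; ring.
    have : divides pi Q.
      case/(residue_dividesM res): daQ => // da.
      by case/(residue_dividesM res): dbQ => // db; case: nab.
    by move/(fun h => dividesB h (d2 (C * v))); congr divides; rewrite /Q; ring.
  (* This treats [(0 : 1)]. The point [(1 : 0)] follows by exchanging [a] and [b], which alters
     [q(u, v)] by [2 B u v], a multiple of 4. *)
  have one x y : red x = 0 -> red y = 1 -> divides (pi ^+ 2)
      (A * (x ^+ 2 - y ^+ 2) ^+ 2 + B * (x ^+ 2 - y ^+ 2) * (x * y)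
       + C * (x * y) ^+ 2) -> divides pi (B * (x ^+ 2 - y ^+ 2)) -> False.
    move=> x0 y1 df' dBu'.
    have u0 : red (x ^+ 2 - y ^+ 2) != 0.
      by rewrite rmorphB !rmorphXn /= x0 y1 expr0n expr1n sub0r oppr_eq0 oner_eq0.
    have dB : divides pi B.
      by apply: (divides_unitM res (n := 1) u0); rewrite expr1 mulrC.
    have dA : divides (pi ^+ 2) A.
      apply: (divides_unitM res (u := (x ^+ 2 - y ^+ 2) ^+ 2)).
        by rewrite rmorphXn expf_neq0.
      have [beta BE] := dB; have [w xE] := (residue_ker res _).1 x0.
      have [c cE] := df'.
      exists (c - beta * (x ^+ 2 - y ^+ 2) * (w * y) - C * (w * y) ^+ 2).
      by rewrite !mulrBr -cE BE xE; ring.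
    have C0 : red C != 0.
      apply/(residue_ndivides res) => dC; apply: content; split=> //.
      exact: (divides_expS (n := 1) dA).
    exact: C4' C0 dB dA.
  case: (k2 (red a)) (k2 (red b)) => a0 [] b0.
  + by apply: nab; split; apply/(residue_ker res).
  + exact: one a0 b0 df dBu.
  + apply: (one b a b0 a0).
      have [c cE] := df; have [z zE] := dBu; exists (c - z * v).
      rewrite [RHS]mulrBr -cE (_ : pi ^+ 2 * (z * v) = 2 * (B * u) * v).
        by rewrite /u /v; ring.
      by rewrite zE -pi2; ring.
    by move: (dividesN dBu); congr divides; rewrite /u; ring.
  + have [c abE] : divides pi (a - b).
      by apply/(residue_ker res); rewrite rmorphB a0 b0 subrr.
    have v0 : red (v ^+ 2) != 0.
      by rewrite rmorphXn rmorphM a0 b0 mulr1 expf_neq0 ?oner_neq0.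
    apply: C4; apply: (divides_unitM res v0).
    have uE : u = pi ^+ 2 * (c * (c + b)).
      have -> : u = (a - b) * ((a - b) + 2 * b) by rewrite /u; ring.
      by rewrite abE -pi2; ring.
    have [f0 f0E] := df; exists (f0 - c * (c + b) * (A * u + B * v)).
    by rewrite [RHS]mulrBr -f0E [pi ^+ 2 * (_ * (_ + _))]mulrA -uE; ring.
- move=> A0 r s s1 m1 m0 [e1 e0 f1 f0].
  have {}s1 : divides pi (s + 1).
    case: s1 => // s1.
    by have := dividesD s1 (d2 1); congr divides; ring.
  have [rho rhoE] := family_quadratic_neg s1 f0.
  have [beta BE] : divides pi B.
    by have := dividesB e1 (d2 (r * A)); congr divides; rewrite /m1; ring.
  have dB : divides pi B by exists beta.
  case: (k2 (red r)) => r0.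
    have [eta rE] := (residue_ker res _).1 r0.
    apply: C4; exists (rho - A * eta ^+ 2 - beta * eta).
    by rewrite !mulrBr -rhoE BE rE; ring.
  have [t tE] : divides pi (r - 1).
    by apply/(residue_ker res); rewrite rmorphB r0 rmorph1 subrr.
  have ABC : divides (pi ^+ 2) (A - B + C).
    exists (rho - A * (t * (t + 1)) - beta * t - beta).
    have rE : r = pi * t + 1 by rewrite -tE subrK.
    have -> : A - B + C = A * r ^+ 2 + B * r + C - A * (pi * t * (pi * t + 2))
        - B * (pi * t) - 2 * B by rewrite rE; ring.
    by rewrite rhoE BE -pi2; ring.
  (* If [C] were even, so would be [A = (A - B + C) + B - C], a unit. *)
  have [|_ //] := AC4 _ dB; move=> dC.
  move/negP: A0; apply; apply/eqP/(residue_ker res).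
  have := dividesB (dividesD (divides_expS (n := 1) ABC) dB) dC.
  by congr divides; ring.
Qed.

End Family.

(** * Specialisation to [Z_p] and return to integral congruences *)

Lemma padic_residue_map (p : nat) (p_pr : prime p) :
  residue_map (p%:R : padic_int p) (padic_residue p_pr).
Proof.
split.
- exact: padic_pmulI.
- exact: padic_residue_surj.
- move=> x; split=> [/(padic_red_eq0 p_pr)//|[y ->]].
  by rewrite rmorphM rmorph_nat pchar_Fp_0 // mul0r.
- by move=> x /(padic_red_unit p_pr)[y xy]; exists y.
Qed.

(** Stated as an equality of propositions so that it can be used to rewrite inside the criteria. *)
Lemma padic_divides (p : nat) (p_pr : prime p) n (m : int) (x : padic_int p) :
  x = m%:~R -> divides (p%:R ^+ n.+1) x = (p%:Z ^+ n.+1 %| m)%Z :> Prop.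
Proof. by move=> ->; apply/propext; apply: padic_dvdz. Qed.

Lemma neq0_modz (m d : int) : is_true (m != 0 %[mod d])%Z = (~ (d %| m)%Z).
Proof. by apply/propext; rewrite eqz_mod_dvd subr0; split=> /negP. Qed.

Theorem theorem4p3 (A B C : int) :
  let F := BinaryQuartic A B (C - 2 * A) (- B) A in
  (forall p : nat, prime p -> odd p ->
     maximal_at p F <->
     [/\ ~ [/\ (p %| A)%Z, (p %| B)%Z & (p %| C)%Z],
         (B ^+ 2 - 4 * A * C != 0 %[mod p%:Z ^+ 2])%Z,
         (p %| 4 * A - C)%Z /\ (p %| B)%Z ->
           ((4 * A - C) ^+ 2 + 4 * B ^+ 2 != 0 %[mod p%:Z ^+ 3])%Z
       & ~ ((p %| 4 * A - C)%Z /\ (p %| B)%Z) ->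
           ((4 * A - C) ^+ 2 + 4 * B ^+ 2 != 0 %[mod p%:Z ^+ 2])%Z])
  /\
  (maximal_at 2 F <->
     [/\ ~ [/\ (2 %| A)%Z, (2 %| B)%Z & (2 %| C)%Z],
         (C != 0 %[mod 4])%Z
       & ~ (2 %| C)%Z -> (2 %| B)%Z ->
           (A != 0 %[mod 4])%Z /\ (A - B + C != 0 %[mod 4])%Z]).
Proof.
move=> F.
have FE p : maximal_at p F = maximal_quartic_ring
    (bq_ring (BinaryQuartic A%:~R B%:~R (C%:~R - 2 * A%:~R) (- B%:~R) A%:~R)
     : comAlgType (padic_int p)).
  rewrite /maximal_at /bq_ring_tensor /map_bq /=.
  by rewrite rmorphB rmorphM rmorphN /= -[2%:~R]/(2%:R).
split=> [p p_pr p_odd|].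
  rewrite FE.
  have two : padic_residue p_pr 2 != 0.
    by rewrite rmorph_nat -(dvdn_pcharf (pchar_Fp p_pr)) gtnNdvd // odd_prime_gt2.
  have dv n m := padic_divides p_pr n (erefl (m%:~R : padic_int p)).
  apply: (iff_trans (family_maximal_iff_odd (padic_residue_map p_pr) _ _ _ two)).
  have e1 : 4 * A%:~R - C%:~R = (4 * A - C)%:~R :> padic_int p.
    by rewrite rmorphB rmorphM.
  have e2 : B%:~R ^+ 2 - 4 * A%:~R * C%:~R
      = (B ^+ 2 - 4 * A * C)%:~R :> padic_int p.
    by rewrite rmorphB rmorphXn !rmorphM.
  have e3 : (4 * A - C)%:~R ^+ 2 + 4 * B%:~R ^+ 2
      = ((4 * A - C) ^+ 2 + 4 * B ^+ 2)%:~R :> padic_int p.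
    by rewrite [RHS]rmorphD rmorphM !rmorphXn.
  rewrite e1 e2 e3 !neq0_modz (dv 0%N A) !(dv 0%N B) (dv 0%N C).
  by rewrite !(dv 0%N (4 * A - C)) !(dv 1%N) (dv 2%N).
rewrite FE; have p_pr : prime 2 by [].
have dv n m := padic_divides p_pr n (erefl (m%:~R : padic_int 2)).
have F2 (x : 'F_2) : x = 0 \/ x = 1.
  by case: x => [[|[|//]] lt_x]; [left|right]; apply: val_inj.
apply: (iff_trans (family_maximal_iff_two (padic_residue_map p_pr) _ _ _ erefl F2)).
have e1 : A%:~R - B%:~R + C%:~R = (A - B + C)%:~R :> padic_int 2.
  by rewrite rmorphD rmorphB.
by rewrite e1 !neq0_modz (dv 0%N A) !(dv 0%N B) !(dv 0%N C) !(dv 1%N).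
Qed.
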